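(* $\mathsf{BPP/samp}=\mathsf{P/samp}$.
   Context: For a language $L$, $L(x)=1$ if $x\in L$ and $0$ otherwise. A language $L$ is in $\mathsf{BPP/samp}$ if there exist probabilistic polynomial-time Turing machines $M$ and $D$ such that: on input $1^n$, $D$ produces an output distribution $\mathcal D_n$ over strings; $M$ takes an input $x$ of size $n$ together with a set of samples $\mathcal T=\{(x_i,L(x_i))\}_{i=1}^{\mathrm{poly}(n)}$ with each $x_i$ drawn from $\mathcal D_n$, and outputs 1 with probability greater than $2/3$ if $x\in L$ and less than $1/3$ if $x\notin L$, the probability being over both the sample selection and the random coins of $M$. $\mathsf{P/samp}$ is defined identically except that $M$ is a deterministic polynomial-time Turing machine (so the probability is over the sample selection only). *)

(* Defs.v *)
From mathcomp Require Import all_boot.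
Set Implicit Arguments.
Unset Strict Implicit.
Unset Printing Implicit Defensive.

Definition sym := nat.
Definition Blank : sym := 0.
Definition Zero  : sym := 1.
Definition One   : sym := 2.
Definition Sep   : sym := 3.

Inductive move := MoveL | MoveR | Stay.

(** A (single-tape, deterministic) Turing machine is a finite transition
    table of entries (q, a, q', b, m): in state q reading a, go to state q',
    write b, move m.  The first matching entry is used; the machine halts
    when no entry matches.  The start state is 0. *)
Definition TM := seq (nat * sym * nat * sym * move).

Record conf := Conf { cst : nat; cleft : seq sym; chead : sym; cright : seq sym }.

Definition lookup (M : TM) (q : nat) (a : sym) :=
  ohead [seq t <- M | (t.1.1.1.1 == q) && (t.1.1.1.2 == a)].

Definition do_move (m : move) (c : conf) : conf :=
  match m with
  | MoveL => match cleft c with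
             | [::] => Conf (cst c) [::] Blank (chead c :: cright c)
             | a :: l => Conf (cst c) l a (chead c :: cright c)
             end
  | MoveR => match cright c with
             | [::] => Conf (cst c) (chead c :: cleft c) Blank [::]
             | a :: r => Conf (cst c) (chead c :: cleft c) a r
             end
  | Stay => c
  end.

Definition step (M : TM) (c : conf) : option conf :=
  match lookup M (cst c) (chead c) with
  | None => None
  | Some t => Some (do_move t.2 (Conf t.1.1.2 (cleft c) t.1.2 (cright c)))
  end.

Fixpoint run (M : TM) (t : nat) (c : conf) : conf :=
  match t with
  | 0 => c
  | t'.+1 => match step M c with None => c | Some c' => run M t' c' end
  end.

Definition halted (M : TM) (c : conf) : bool :=
  if step M c is None then true else false.

Definition init (w : seq sym) : conf :=
  match w with [::] => Conf 0 [::] Blank [::] | a :: r => Conf 0 [::] a r end.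

Definition poly_eval (cs : seq nat) (n : nat) : nat :=
  foldr (fun c acc => c + n * acc) 0 cs.

Definition input_word (w : seq sym) : bool :=
  all (fun a => (a == Zero) || (a == One) || (a == Sep)) w.

Definition poly_time (M : TM) (tb : seq nat) : Prop :=
  forall w, input_word w -> halted M (run M (poly_eval tb (size w)) (init w)).

Definition output (M : TM) (tb : seq nat) (w : seq sym) : conf :=
  run M (poly_eval tb (size w)) (init w).

Definition accepts (c : conf) : bool := chead c == One.

Definition is_bit (a : sym) : bool := (a == Zero) || (a == One).

Definition out_bits (c : conf) : seq bool :=
  let s := chead c :: cright c in
  map (fun a => a == One) (take (find (fun a => ~~ is_bit a) s) s).

Definition enc_bit (b : bool) : sym := if b then One else Zero.
Definition enc_bits (x : seq bool) : seq sym := map enc_bit x.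

(** The sampler D on input 1^n with random coins r: input "1^n # r". *)
Definition sampler_out (D : TM) (tD : seq nat) (n : nat) (r : seq bool) :=
  out_bits (output D tD (nseq n One ++ Sep :: enc_bits r)).

(** Input of M: "x # x_1 # b_1 # ... x_s # b_s # r" with r M's coins. *)
Definition enc_input (x : seq bool) (T : seq (seq bool * bool)) (r : seq bool) :=
  enc_bits x ++ Sep ::
  flatten [seq enc_bits p.1 ++ [:: Sep; enc_bit p.2; Sep] | p <- T] ++ enc_bits r.

Definition language := seq bool -> bool.

(** The class with sampling advice.  [sN n] samples, each drawn from D_n
    using [qD n] independent uniform coins; M uses [pM n] uniform coins.
    If [det] holds, M uses no coins (deterministic machine).
    Probabilities are counted over the finite uniform sample space. *)
Definition samp_class (det : bool) (L : language) : Prop :=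
  exists (M D : TM) (tM tD qD pM sN : seq nat),
    (det -> pM = [::]) /\ poly_time M tM /\ poly_time D tD /\
    forall x : seq bool,
      let n := size x in
      let E := [set w : {ffun 'I_(poly_eval sN n) -> (poly_eval qD n).-tuple bool}
                        * (poly_eval pM n).-tuple bool
               | accepts (output M tM (enc_input x
                   [seq (let y := sampler_out D tD n (w.1 i) in (y, L y))
                   | i <- enum 'I_(poly_eval sN n)] w.2))] in
      let Om := #|[set: {ffun 'I_(poly_eval sN n) -> (poly_eval qD n).-tuple bool}
                        * (poly_eval pM n).-tuple bool]| in
      if L x then 2 * Om < 3 * #|E| else 3 * #|E| < Om.

Definition BPPsamp (L : language) : Prop := samp_class false L.
Definition Psamp (L : language) : Prop := samp_class true L.

(* Main.v *)
Require Import Defs.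
From mathcomp Require Import all_boot.
From mathcomp Require Import all_order all_algebra.
From mathcomp Require Import zify ring lra.
Set Implicit Arguments.
Unset Strict Implicit.
Unset Printing Implicit Defensive.
Import Order.TTheory GRing.Theory Num.Theory.

(** Labelled samples can serve as coins if the sampler is modified to flip one
    extra coin [c]: for [c = 0] it outputs a sample [D(u)] as before, for
    [c = 1] it outputs fresh random bits, padded to a length which [D] cannot
    reach in its running time.  The length tells the two kinds of samples
    apart, the labels of the random strings are ignored, and the deterministic
    machine runs [M] on the first [s] genuine samples with the coins taken from
    the first random string.  Among [N] samples this fails with probability at
    most [(3/4)^N * 2^(s+1)].  The error probability of [M] is a multiple of
    [1/2^(qs+p)] below [1/3], hence below it by at least [1/(3 * 2^(qs+p))], and
    a polynomial [N] makes the failure probability smaller than this gap: no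
    amplification is needed.

    The two machines consist of a program over several stacks followed by the
    given machine.  Cell [y] of the tape holds, as base 5 digits, the [y]-th
    symbols from the bottom of all stacks; a tape over the input alphabet then
    already is the store whose stack 0 holds the input, and a store whose other
    stacks are empty already is a plain tape. *)

(** * Runs and tapes *)

(** The label of a sample is dictated by [L] and may be uncomputable, so the kind of a sample has to
    be readable from the string itself; this is why length is used. How many samples of each kind
    arrive is random, whereas [M] expects exactly [s] samples and [p] coins. Conditioning on enough
    of each is avoided. Reading the samples one by one, the value that [M] would have if everything
    still missing were drawn ideally is unchanged on average, and the true value exceeds it by at
    most a potential. The potential carries a factor 2 for every missing item. When something is
    missing, a sample halves it with probability at least 1/2 and never increases it, whence the
    factor 3/4. If something is missing at the end, the potential is at least 1, which covers any
    outcome; the initial factor is [2^(s+1)] for [s] samples and one random string. Only upper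
    bounds on acceptance are proved. For [x] in [L] they are applied to rejection. *)

Lemma runD M a b c : run M (a + b) c = run M b (run M a c).
Proof.
elim: a c => [|a IH] c //=; case E: (step M c) => [d|]; first exact: IH.
by case: b {IH} => [|b] /=; rewrite ?E.
Qed.

Lemma run_halted M a b c : halted M (run M a c) -> a <= b -> run M b c = run M a c.
Proof.
move=> h /subnKC <-; rewrite runD; move: h; rewrite /halted.
by case: (b - a) => [|n] //=; case: (step M _).
Qed.

(** Equality up to trailing blanks. A program leaves blanks around the word it hands over; they do
    not affect a later run, but they prevent equality of lists. *)
Definition tape_eq (l l' : seq nat) := forall j, nth 0 l j = nth 0 l' j.

Definition conf_eq c c' :=
  [/\ cst c = cst c', chead c = chead c',
      tape_eq (cleft c) (cleft c') & tape_eq (cright c) (cright c')].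

Lemma do_moveE m c : do_move m c =
  match m with
  | MoveL => Conf (cst c) (behead (cleft c)) (nth 0 (cleft c) 0)
                  (chead c :: cright c)
  | MoveR => Conf (cst c) (chead c :: cleft c) (nth 0 (cright c) 0)
                  (behead (cright c))
  | Stay => c
  end.
Proof. by case: m => //; case: c => q [|? ?] h [|? ?]. Qed.

Lemma do_move_conf_eq m c c' : conf_eq c c' -> conf_eq (do_move m c) (do_move m c').
Proof.
move=> [eq eh el er]; rewrite !do_moveE; case: m; split => //=; try by rewrite ?el ?er.
- by move=> j; rewrite !nth_behead.
- by case=> [|j] //=.
- by case=> [|j] //=.
- by move=> j; rewrite !nth_behead.
Qed.

Lemma step_conf_eq M c c' : conf_eq c c' ->
  match step M c, step M c' with
  | Some d, Some d' => conf_eq d d' | None, None => True | _, _ => False end.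
Proof.
move=> e; have [eq eh el er] := e; rewrite /step eq eh.
by case: (lookup M _ _) => [t|//]; apply: do_move_conf_eq; split.
Qed.

Lemma run_conf_eq M t c c' : conf_eq c c' -> conf_eq (run M t c) (run M t c').
Proof.
elim: t c c' => [|t IH] c c' e //=; have := step_conf_eq M e.
by case: (step M c) => [d|]; case: (step M c') => [d'|] //; apply: IH.
Qed.

Lemma halted_conf_eq M c c' : conf_eq c c' -> halted M c = halted M c'.
Proof.
move=> e; have := step_conf_eq M e; rewrite /halted.
by case: (step M c) => [d|]; case: (step M c').
Qed.

Definition bits_prefix (s : seq nat) :=
  [seq a == One | a <- take (find (fun a => ~~ is_bit a) s) s].

Lemma bits_prefix_tape_eq s s' : tape_eq s s' -> bits_prefix s = bits_prefix s'.
Proof.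
rewrite /bits_prefix.
elim: s s' => [|a s IH] [|b s'] //= e.
- by have := e 0 => /= <-.
- by have := e 0 => /= ->.
have /= <- := e 0; case: (is_bit a) => //=; congr (_ :: _); apply: IH => j.
exact: (e j.+1).
Qed.

Lemma out_bits_conf_eq c c' : conf_eq c c' -> out_bits c = out_bits c'.
Proof.
move=> [_ eh _ er]; apply: (@bits_prefix_tape_eq (_ :: _) (_ :: _)).
by case=> [|j] //=.
Qed.

(* The tape is [g], extended by blanks to the left of cell 0; the head is on
   cell [x]. *)
Definition at_pos (q : nat) (g : nat -> nat) (x : nat) (c : conf) :=
  [/\ cst c = q, chead c = g x,
      (forall j, nth 0 (cright c) j = g (x + j).+1) &
      (forall j, nth 0 (cleft c) j = if j < x then g (x - j.+1) else 0)].

Lemma at_pos_ext q g g' x c : g =1 g' -> at_pos q g x c -> at_pos q g' x c.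
Proof.
move=> e [a b h i]; split => //; rewrite -?e // => j; first by rewrite h e.
by rewrite i e.
Qed.

Definition set_cell (g : nat -> nat) x b := fun y => if y == x then b else g y.

Definition pos_move m x :=
  match m with MoveL => x.-1 | MoveR => x.+1 | Stay => x end.

Ltac cells :=
  repeat (case: eqP => ?); repeat (case: ltnP => ?); try lia; try (congr (_ _); lia).

Lemma step_at M q g x c coin_count b m :
  at_pos q g x c -> lookup M q (g x) = Some (q, g x, coin_count, b, m) ->
  (m = MoveL -> 0 < x) ->
  exists2 c', step M c = Some c' & at_pos coin_count (set_cell g x b) (pos_move m x) c'.
Proof.
move=> [eq eh er el] lk xm; rewrite /step eq eh lk /=.
eexists; first by []; rewrite do_moveE /set_cell; case: m {lk} xm => /= xm.
- have {}xm := xm erefl; split => //= [||j].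
  + by rewrite el xm; cells.
  + by case=> [|j] /=; rewrite ?er; cells.
  + by rewrite nth_behead el; cells.
- split => //= [|j|[|j]] /=.
  + by rewrite er; cells.
  + by rewrite nth_behead er; cells.
  + by cells.
  + by rewrite el; cells.
- split => //= [|j|j]; first by rewrite eqxx.
  + by rewrite er; cells.
  + by rewrite el; cells.
Qed.

Definition goes M c t (Q : conf -> Prop) := exists2 t', t' <= t & Q (run M t' c).

Lemma goes0 M c (Q : conf -> Prop) : Q c -> goes M c 0 Q.
Proof. by move=> h; exists 0. Qed.

Lemma goes_trans M c t u (Q Q' : conf -> Prop) :
  goes M c t Q -> (forall c', Q c' -> goes M c' u Q') -> goes M c (t + u) Q'.
Proof.
move=> [t' ht hQ] /(_ _ hQ) [u' hu hQ']; exists (t' + u'); last by rewrite runD.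
exact: leq_add.
Qed.

Lemma goes_le M c t u (Q : conf -> Prop) : goes M c t Q -> t <= u -> goes M c u Q.
Proof. by move=> [t' h hQ] tu; exists t' => //; apply: leq_trans tu. Qed.

Lemma goes_step M q g x c coin_count b m t Q :
  at_pos q g x c -> lookup M q (g x) = Some (q, g x, coin_count, b, m) ->
  (m = MoveL -> 0 < x) ->
  (forall c', at_pos coin_count (set_cell g x b) (pos_move m x) c' -> goes M c' t Q) ->
  goes M c t.+1 Q.
Proof.
move=> ha lk xm k; have [c' e /k [t' ht hq]] := step_at ha lk xm.
by exists t'.+1 => //=; rewrite e.
Qed.

Lemma set_cell_id g x : set_cell g x (g x) =1 g.
Proof. by move=> y; rewrite /set_cell; case: eqP => [->|]. Qed.

Lemma seekR M q g x n c :
  (forall y, x <= y < x + n -> lookup M q (g y) = Some (q, g y, q, g y, MoveR)) ->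
  at_pos q g x c -> goes M c n (at_pos q g (x + n)).
Proof.
elim: n x c => [|n IH] x c lk ha; first by rewrite addn0; apply: goes0.
have hx : x <= x < x + n.+1 by lia.
apply: (goes_step ha (lk x hx)) => //=.
move=> c' /(at_pos_ext (set_cell_id g x)) h; rewrite addnS -addSn.
by apply: IH h => y hy; apply: lk; lia.
Qed.

Lemma seekL M q g n c :
  (forall y, 0 < y <= n -> lookup M q (g y) = Some (q, g y, q, g y, MoveL)) ->
  at_pos q g n c -> goes M c n (at_pos q g 0).
Proof.
elim: n c => [|n IH] c lk ha; first exact: goes0.
apply: (goes_step ha (lk n.+1 _)) => //=; try lia.
move=> c' /(at_pos_ext (set_cell_id g _)) h.
by apply: IH h => y hy; apply: lk; lia.
Qed.

(** * Several stacks as tracks of one tape *)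

Fixpoint enc k (f : nat -> nat) : nat :=
  if k is k'.+1 then f 0 + 5 * enc k' (fun i => f i.+1) else 0.

Fixpoint dec (a i : nat) : nat :=
  if i is i'.+1 then dec (a %/ 5) i' else a %% 5.

Lemma eq_enc k f f' : (forall i, i < k -> f i = f' i) -> enc k f = enc k f'.
Proof.
elim: k f f' => [|k IH] f f' e //=; rewrite e //; congr (_ + 5 * _).
by apply: IH => i hi; apply: e.
Qed.

Lemma enc_bound k f : (forall i, i < k -> f i < 5) -> enc k f < 5 ^ k.
Proof.
elim: k f => [|k IH] f h //=; rewrite expnS.
by have := h 0 isT; have := IH (fun i => f i.+1) (fun i hi => h i.+1 hi); lia.
Qed.

Lemma dec_enc k f i : (forall i, i < k -> f i < 5) -> i < k -> dec (enc k f) i = f i.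
Proof.
elim: k f i => [|k IH] f [|i] h //= hi; have h0 := h 0 isT; first lia.
have ->: (f 0 + 5 * enc k (fun i => f i.+1)) %/ 5 = enc k (fun i => f i.+1) by lia.
by rewrite IH // => j hj; apply: h.
Qed.

Lemma dec0 i : dec 0 i = 0.
Proof. by elim: i => //= i IH; rewrite div0n. Qed.

Lemma enc_single k f : 0 < k -> (forall i, 0 < i -> f i = 0) -> enc k f = f 0.
Proof.
case: k => // k _ h /=; suff e0 : forall k f, (forall i, f i = 0) -> enc k f = 0.
  by rewrite e0 => [|i]; [lia | apply: h].
by elim=> [//|k' IH] f' h' /=; rewrite h' IH.
Qed.

Definition col (l : seq nat) y := nth 0 (rev l) y.

Lemma col_cons a l y : col (a :: l) y = if y == size l then a else col l y.
Proof.
rewrite /col rev_cons nth_rcons size_rev; case: ltngtP => // h.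
by rewrite nth_default ?size_rev // ltnW.
Qed.

Lemma col_lt l y : all (fun a => a < 5) l -> col l y < 5.
Proof.
move=> /allP h; rewrite /col; case: (ltnP y (size (rev l))) => hy.
  by apply: h; rewrite -mem_rev mem_nth.
by rewrite nth_default.
Qed.

Lemma col_pos l y : all (fun a => 0 < a) l -> (col l y != 0) = (y < size l).
Proof.
move=> /allP h; rewrite /col; case: ltnP => hy.
  by have: 0 < nth 0 (rev l) y; [apply: h; rewrite -mem_rev mem_nth // size_rev | lia].
by rewrite nth_default ?size_rev.
Qed.

(** The digit 0 is reserved for the cells above the top of a stack, so that a scan can detect the
    top. The value 4 lies outside the input alphabet and is available as a marker. *)
Definition good_sym a := 0 < a < 5.
Definition good_store k (st : seq (seq nat)) := size st = k /\ all (all good_sym) st.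

Definition reg (st : seq (seq nat)) i := nth [::] st i.
Notation upd st i l := (set_nth [::] st i l).

Lemma reg_upd st i l j : reg (upd st i l) j = if j == i then l else reg st j.
Proof. by rewrite /reg nth_set_nth. Qed.

Lemma reg_good k st i : good_store k st -> all good_sym (reg st i).
Proof.
case=> _ /allP h; rewrite /reg; case: (ltnP i (size st)) => hi.
  by apply: h; rewrite mem_nth.
by rewrite nth_default.
Qed.

Lemma upd_good k st i l : good_store k st -> i < k -> all good_sym l ->
  good_store k (upd st i l).
Proof.
move=> [hs h] hi hl; split; first by rewrite size_set_nth hs; apply/maxn_idPr.
apply/(all_nthP [::]) => j; rewrite size_set_nth hs (maxn_idPr hi) => hj.
rewrite nth_set_nth /=; case: eqP => // _.
by apply: (allP h); rewrite mem_nth ?hs.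
Qed.

(** Cell 0 is blank on all tracks and serves as the left end marker at which every leftward scan
    stops; the bottoms of the stacks are in cell 1. *)
Definition tape k st x :=
  if x is y.+1 then enc k (fun i => col (reg st i) y) else 0.

Section Track.
Variable k : nat.
Implicit Type st : seq (seq nat).

Lemma tape_digit st x i : good_store k st -> i < k ->
  dec (tape k st x) i = if x is y.+1 then col (reg st i) y else 0.
Proof.
move=> g hi; case: x => [|y] /=; first exact: dec0.
rewrite dec_enc // => j hj; apply: col_lt.
by apply: sub_all (reg_good j g) => a /andP[].
Qed.

Lemma tape_nz st x i : good_store k st -> i < k ->
  (dec (tape k st x) i != 0) = (0 < x <= size (reg st i)).
Proof.
move=> g hi; rewrite tape_digit //; case: x => [|y] //=.
by rewrite col_pos //; apply: sub_all (reg_good i g) => a /andP[].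
Qed.

Lemma tape_lt st x : good_store k st -> tape k st x < 5 ^ k.
Proof.
move=> g; case: x => [|y] /=; first by rewrite expn_gt0.
apply: enc_bound => j hj; apply: col_lt.
by apply: sub_all (reg_good j g) => a /andP[].
Qed.

Definition set_digit a i b := enc k (fun j => if j == i then b else dec a j).

Lemma set_digit_push st i b : good_store k st -> i < k ->
  set_cell (tape k st) (size (reg st i)).+1 (set_digit (tape k st (size (reg st i)).+1) i b)
  =1 tape k (upd st i (b :: reg st i)).
Proof.
move=> g hi x; rewrite /set_cell; case: eqP => [->|hx].
  apply: eq_enc => j hj; rewrite reg_upd; case: eqP => [_|_].
    by rewrite col_cons eqxx.
  by rewrite tape_digit.
case: x hx => [|y] //= hy; apply: eq_enc => j hj; rewrite reg_upd.
by case: eqP => // ->; rewrite col_cons; case: eqP => // e; lia.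
Qed.

Lemma set_digit_pop st i v l : good_store k st -> i < k -> reg st i = v :: l ->
  set_cell (tape k st) (size l).+1 (set_digit (tape k st (size l).+1) i 0)
  =1 tape k (upd st i l).
Proof.
move=> g hi e x; rewrite /set_cell; case: eqP => [->|hx].
  apply: eq_enc => j hj; rewrite reg_upd; case: eqP => [_|_].
    by rewrite /col nth_default ?size_rev.
  by rewrite tape_digit.
case: x hx => [|y] //= hy; apply: eq_enc => j hj; rewrite reg_upd.
by case: eqP => // ->; rewrite e col_cons; case: eqP => // e'; lia.
Qed.

End Track.
Arguments tape : simpl never.

Lemma tape0 k st : tape k st 0 = 0.
Proof. by []. Qed.

(** * Stack instructions *)

(* Read the top [v] of stack [src] (0 when empty), pop it if [del], push
   [put v] on [dst] unless it is 0, and continue at instruction [next v]. *)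
Record instr := Instr
  { src : nat; del : bool; dst : nat; put : nat -> nat; next : nat -> nat }.

Definition act i (e : bool) j (g : nat -> nat) st :=
  let v := head 0 (reg st i) in
  let st1 := if e then upd st i (behead (reg st i)) else st in
  if g v == 0 then st1 else upd st1 j (g v :: reg st1 j).

Definition top (st : seq (seq nat)) i := head 0 (reg st i).

Definition vstep P (pc : nat) st :=
  let s := nth (Instr 0 false 0 id id) P pc in
  (next s (top st (src s)), act (src s) (del s) (dst s) (put s) st).

Fixpoint vrun P n pc st pc' st' : Prop :=
  if n is n'.+1 then
    pc < size P /\ vrun P n' (vstep P pc st).1 (vstep P pc st).2 pc' st'
  else pc = pc' /\ st = st'.

Definition wf_instr k (s : instr) :=
  [/\ src s < k, dst s < k & forall v, v < 5 -> put s v < 5].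

Lemma lookup_cat A B q a :
  lookup (A ++ B) q a = if lookup A q a is Some t then Some t else lookup B q a.
Proof. by rewrite /lookup filter_cat; case: (filter _ A). Qed.

Lemma lookup_none A q a : all (fun t => t.1.1.1.1 != q) A -> lookup A q a = None.
Proof.
rewrite /lookup => h.
suff -> : [seq t <- A | (t.1.1.1.1 == q) && (t.1.1.1.2 == a)] = [::] by [].
by elim: A h => [|t A IH] //= /andP[/negPf -> /IH].
Qed.

Lemma lookup_map (E : eqType) (f : E -> nat * sym * nat * sym * move) es e q a :
  (f e).1.1.1 = (q, a) -> e \in es ->
  (forall e', (f e').1.1.1 = (q, a) -> e' \in es -> e' = e) ->
  lookup (map f es) q a = Some (f e).
Proof.
move=> fe; rewrite /lookup; elim: es => [|e1 es IH] // he hu /=.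
case: ifP => [/andP[/eqP h1 /eqP h2]|hn].
  congr (Some (f _)); apply: hu; last exact: mem_head.
  by rewrite -h1 -h2; case: (f e1).1.1.1.
apply: IH => [|e' fe' h']; last by apply: hu => //; rewrite inE h' orbT.
by move: he; rewrite inE => /orP[/eqP e1e|//]; move: hn; rewrite -e1e fe /= !eqxx.
Qed.

(** Locked, so that simplification does not enumerate the [5 ^ k] tape symbols. *)
Definition rng (n : nat) : seq nat := locked (iota 0 n).

Lemma mem_rng n i : (i \in rng n) = (i < n).
Proof. by rewrite /rng -lock mem_iota. Qed.

(** * The Turing machine that simulates a stack program *)

Section Machine.
Variables (k : nat) (P : seq instr) (M : TM).

(* Even states run the program, odd states run [M]. *)
Definition state_at pc ph v := ((pc * 5 + ph) * 5 + v).*2.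

(* Phases: 0 seek the top of [src], 1 read it, 2 return to the first cell,
   3 seek the top of [dst] and push, 4 return.  The register [v] holds the symbol
   read. *)
Definition delta pc ph v (a : nat) : nat * nat * move :=
  let s := nth (Instr 0 false 0 id id) P pc in
  let i := src s in let j := dst s in
  match ph with
  | 0 => if dec a i != 0 then (state_at pc 0 v, a, MoveR) else (state_at pc 1 0, a, MoveL)
  | 1 => if dec a i == 0 then (state_at pc 3 0, a, MoveR)
         else (state_at pc 2 (dec a i), if del s then set_digit k a i 0 else a, MoveL)
  | 2 => if dec a i != 0 then (state_at pc 2 v, a, MoveL) else (state_at pc 3 v, a, MoveR)
  | 3 => if put s v == 0 then (state_at (next s v) 0 0, a, Stay)
         else if dec a j != 0 then (state_at pc 3 v, a, MoveR)
         else (state_at pc 4 v, set_digit k a j (put s v), MoveL)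
  | _ => if dec a j != 0 then (state_at pc 4 v, a, MoveL)
         else (state_at (next s v) 0 0, a, MoveR)
  end.

Definition table : TM :=
  [seq (state_at e.1.1 e.1.2 e.2.1, e.2.2, (delta e.1.1 e.1.2 e.2.1 e.2.2).1.1,
        (delta e.1.1 e.1.2 e.2.1 e.2.2).1.2, (delta e.1.1 e.1.2 e.2.1 e.2.2).2)
   | e <- [seq (x, y) | x <- [seq (pc, ph) | pc <- rng (size P), ph <- rng 5],
                        y <- [seq (v, a) | v <- rng 5, a <- rng (5 ^ k)]]].

(* After the program: control passes to the start state of [M], except that
   the symbol 4 is rewritten to [One] and the machine stops. *)
Definition glue : TM :=
  [seq (state_at (size P) 0 0, a, if a == 4 then state_at (size P).+1 0 0 else 1,
        if a == 4 then One else a, Stay) | a <- rng (5 ^ k)].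

Definition shifted : TM :=
  [seq (t.1.1.1.1.*2.+1, t.1.1.1.2, t.1.1.2.*2.+1, t.1.2, t.2) | t <- M].

Definition machine : TM := table ++ glue ++ shifted.

(** The key of an entry determines the entry, because [state_at] is injective for phases and
    registers below 5; hence the first match is the intended one. *)
Lemma lookup_table pc ph v a : pc < size P -> ph < 5 -> v < 5 -> a < 5 ^ k ->
  lookup machine (state_at pc ph v) a =
  Some (state_at pc ph v, a, (delta pc ph v a).1.1, (delta pc ph v a).1.2, (delta pc ph v a).2).
Proof.
move=> hpc hph hv ha; rewrite lookup_cat.
rewrite (@lookup_map _ _ _ ((pc, ph), (v, a))) //.
- by rewrite !allpairs_f // mem_rng.
- move=> [[pc' ph'] [v' a']] /= [e ->] /allpairsP[[x y] [hx hy /= [ex ey]]].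
  move: hx hy; rewrite -{}ex -{}ey => /allpairsP[[x1 x2] [_ hx /= [ex1 ex2]]].
  case/allpairsP=> [[y1 y2] [hy _ /= [ey1 ey2]]].
  move: hx hy; rewrite -ex2 -ey1 !mem_rng /= => hx hy.
  move: e; rewrite /state_at => e.
  have -> : pc' = pc by lia.
  have -> : ph' = ph by lia.
  by have -> : v' = v by lia.
Qed.

Lemma lookup_glue a : a < 5 ^ k ->
  lookup machine (state_at (size P) 0 0) a =
  Some (state_at (size P) 0 0, a, if a == 4 then state_at (size P).+1 0 0 else 1,
        if a == 4 then One else a, Stay).
Proof.
move=> ha; rewrite lookup_cat (@lookup_none table); last first.
  rewrite all_map; apply/allP => _ /allpairsP[[x y] [hx hy ->]].
  case/allpairsP: hx => [[x1 x2] [h1 h2 /= ->]].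
  case/allpairsP: hy => [[y1 y2] [h3 _ /= ->]] /=.
  by move: h1 h2 h3; rewrite /state_at !mem_rng /=; lia.
rewrite lookup_cat (@lookup_map _ _ _ a) //; first by rewrite mem_rng.
by move=> e' /= [].
Qed.

Lemma lookup_halt a : lookup machine (state_at (size P).+1 0 0) a = None.
Proof.
apply: lookup_none; rewrite !all_cat; apply/and3P; split.
- rewrite all_map; apply/allP => _ /allpairsP[[x y] [hx hy ->]].
  case/allpairsP: hx => [[x1 x2] [h1 h2 /= ->]].
  case/allpairsP: hy => [[y1 y2] [h3 _ /= ->]] /=.
  by move: h1 h2 h3; rewrite /state_at !mem_rng /=; lia.
- by rewrite all_map; apply/allP => a' _ /=; rewrite /state_at; lia.
- by rewrite all_map; elim: M => //= t M' ->; rewrite /state_at; lia.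
Qed.

Lemma lookup_shifted q a :
  lookup machine q.*2.+1 a =
  omap (fun t => (t.1.1.1.1.*2.+1, t.1.1.1.2, t.1.1.2.*2.+1, t.1.2, t.2)) (lookup M q a).
Proof.
rewrite /machine catA lookup_cat (@lookup_none (table ++ glue)); last first.
  rewrite all_cat !all_map; apply/andP; split; apply/allP => e' _ /=.
    by rewrite /state_at; lia.
  by rewrite /state_at; lia.
rewrite /lookup filter_map /=.
have -> : [seq t <- M | (t.1.1.1.1 == q) && (t.1.1.1.2 == a)] =
  [seq x <- M | preim (fun t => (t.1.1.1.1.*2.+1, t.1.1.1.2, t.1.1.2.*2.+1, t.1.2, t.2))
   (fun t : nat * sym * nat * sym * move => (t.1.1.1.1 == q.*2.+1) && (t.1.1.1.2 == a)) x].
  by apply: eq_filter => t /=; rewrite eqSS (inj_eq double_inj).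
by case: (filter _ M).
Qed.

Definition lift_conf c := Conf (cst c).*2.+1 (cleft c) (chead c) (cright c).

Lemma step_lift c : step machine (lift_conf c) = omap lift_conf (step M c).
Proof.
rewrite /step /= lookup_shifted; case: (lookup M _ _) => [t|] //=.
by congr Some; rewrite !do_moveE; case: t.2.
Qed.

Lemma run_lift t c : run machine t (lift_conf c) = lift_conf (run M t c).
Proof.
by elim: t c => [|t IH] c //=; rewrite step_lift; case: (step M c) => //=.
Qed.

Lemma halted_lift c : halted machine (lift_conf c) = halted M c.
Proof. by rewrite /halted step_lift; case: (step M c). Qed.

Lemma pop_phase st pc c (s := nth (Instr 0 false 0 id id) P pc) :
  good_store k st -> pc < size P -> src s < k ->
  at_pos (state_at pc 0 0) (tape k st) 1 c ->
  goes machine c (2 * size (reg st (src s)) + 3)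
    (at_pos (state_at pc 3 (top st (src s)))
       (tape k (if del s then upd st (src s) (behead (reg st (src s))) else st)) 1).
Proof.
move=> g hpc hi ha; set i := src s in hi *.
have lk st' ph v y : good_store k st' -> ph < 5 -> v < 5 ->
  lookup machine (state_at pc ph v) (tape k st' y) = _ := fun g hp hv =>
  lookup_table hpc hp hv (tape_lt y g).
have -> : 2 * size (reg st i) + 3 = size (reg st i) + (size (reg st i)).+3 by lia.
apply: goes_trans.
  apply: seekR ha => y hy; rewrite lk //= -/s -/i tape_nz //.
  by rewrite (_ : 0 < y <= _); last lia.
move=> c1 ha1; apply: goes_step ha1 _ _ _.
- by rewrite lk.
- by [].
move=> c2 /=; rewrite -/s -/i tape_nz //= ltnn /= => ha2.
have {}ha2 := at_pos_ext (set_cell_id _ _) ha2; rewrite add0n in ha2.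
have gi := reg_good i g; rewrite /top.
(* On an empty stack the head is already on the blank cell 0, and deleting the top leaves the tape
   unchanged. *)
case E: (reg st i) gi ha2 => [|v l] /=.
  move=> _ ha2; apply: (@goes_le _ _ 1); last by [].
  apply: goes_step ha2 _ _ _; first (by rewrite lk); first by rewrite /= tape0 dec0.
  move=> c3 /=; rewrite -/s -/i tape0 dec0 /= => /(at_pos_ext (set_cell_id _ _)) ha3.
  apply: goes0; apply: at_pos_ext ha3 => x; case: ifP => // _.
  case: x => [|x] //; apply: eq_enc => j hj; rewrite reg_upd.
  by case: eqP => // ->; rewrite E.
case/andP=> /andP[v0 v5] gl ha2.
have dv : dec (tape k st (size l).+1) i = v by rewrite tape_digit // E col_cons eqxx.
apply: goes_step ha2 _ _ _; first (by rewrite lk); first by [].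
move=> c3 /=; rewrite -/s -/i dv (negPf (lt0n_neq0 v0)) /=.
pose st1 := if del s then upd st i l else st; rewrite -/st1.
have g1 : good_store k st1 by rewrite /st1; case: (del s) => //; apply: upd_good.
have sz1 : size l <= size (reg st1 i).
  by rewrite /st1; case: (del s); rewrite ?reg_upd ?eqxx ?E.
move=> ha3; have {}ha3 : at_pos (state_at pc 2 v) (tape k st1) (size l) c3.
  apply: at_pos_ext ha3; rewrite /st1; case: (del s); last exact: set_cell_id.
  exact: set_digit_pop g hi E.
have -> : (size l).+2 = size l + 2 by lia.
apply: goes_trans.
  apply: seekL ha3 => y hy; rewrite lk //= -/s -/i tape_nz //.
  by rewrite (_ : 0 < y <= _); last lia.
move=> c4 ha4; apply: (@goes_le _ _ 1); last by [].
apply: goes_step ha4 _ _ _; first (by rewrite lk); first by rewrite /= tape0 dec0.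
move=> c5 /=; rewrite -/s -/i tape0 dec0 /= => /(at_pos_ext (set_cell_id _ _)) ha5.
exact: goes0.
Qed.

Lemma push_phase st pc v c (s := nth (Instr 0 false 0 id id) P pc) :
  good_store k st -> pc < size P -> dst s < k -> v < 5 -> put s v < 5 ->
  at_pos (state_at pc 3 v) (tape k st) 1 c ->
  goes machine c (2 * size (reg st (dst s)) + 2)
    (at_pos (state_at (next s v) 0 0)
       (tape k (if put s v == 0 then st
                else upd st (dst s) (put s v :: reg st (dst s)))) 1).
Proof.
move=> g hpc hj v5 p5 ha; set j := dst s in hj *.
have lk st' ph v y : good_store k st' -> ph < 5 -> v < 5 ->
  lookup machine (state_at pc ph v) (tape k st' y) = _ := fun g hp hv =>
  lookup_table hpc hp hv (tape_lt y g).
case: eqP => [p0|/eqP p0].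
  apply: (@goes_le _ _ 1); last by lia.
  apply: goes_step ha _ _ _; first (by rewrite lk); first by rewrite /= -/s p0.
  move=> c1 /=; rewrite -/s p0 /= => ha1; apply: goes0.
  exact: at_pos_ext (set_cell_id _ _) ha1.
have -> : 2 * size (reg st j) + 2 = size (reg st j) + (size (reg st j)).+2 by lia.
apply: goes_trans.
  apply: seekR ha => y hy; rewrite lk //= -/s -/j (negPf p0) tape_nz //.
  by rewrite (_ : 0 < y <= _); last lia.
move=> c1 ha1; apply: goes_step ha1 _ _ _; first (by rewrite lk); first by [].
move=> c2; rewrite add1n /delta -/s -/j (negPf p0) tape_nz // ltnn andbF /=.
move=> /(at_pos_ext (set_digit_push _ g hj)).
set st1 := upd _ _ _ => ha2.
have g1 : good_store k st1.
  by apply: upd_good => //=; rewrite (reg_good _ g) andbT /good_sym; lia.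
have -> : (size (reg st j)).+1 = size (reg st j) + 1 by lia.
apply: goes_trans.
  apply: seekL ha2 => y hy; rewrite lk //= -/s -/j tape_nz // reg_upd eqxx /=.
  by rewrite (_ : 0 < y <= _); last lia.
move=> c3 ha3; apply: goes_step ha3 _ _ _; first (by rewrite lk); first by rewrite /= tape0 dec0.
move=> c4 /=; rewrite -/s -/j tape0 dec0 /= => ha4; apply: goes0.
exact: at_pos_ext (set_cell_id _ _) ha4.
Qed.

Definition height_le H (st : seq (seq nat)) := forall i, size (reg st i) <= H.

Lemma top_lt st i : good_store k st -> top st i < 5.
Proof.
by move=> /(reg_good i); rewrite /top; case: (reg st i) => [|a l] //= /andP[/andP[]].
Qed.

Lemma behead_good st i : good_store k st -> i < k ->
  good_store k (upd st i (behead (reg st i))).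
Proof.
move=> g hi; apply: upd_good => //; have := reg_good i g.
by case: (reg st i) => //= ? ? /andP[].
Qed.

Lemma act_good st i e j g : good_store k st -> i < k -> j < k ->
  (forall v, v < 5 -> g v < 5) -> good_store k (act i e j g st).
Proof.
move=> gs hi hj hg; rewrite /act.
have gs1 : good_store k (if e then upd st i (behead (reg st i)) else st).
  by case: e => //; apply: behead_good.
case: eqP => // /eqP h0; apply: upd_good => //=; rewrite (reg_good _ gs1) andbT.
by rewrite /good_sym lt0n h0 hg //; apply: top_lt.
Qed.

Lemma behead_height H st i : height_le H st ->
  height_le H (upd st i (behead (reg st i))).
Proof.
move=> h j; rewrite reg_upd; case: eqP => // _; rewrite size_behead.
exact: leq_trans (leq_pred _) (h i).
Qed.

Lemma act_height H st i e j g : height_le H st -> height_le H.+1 (act i e j g st).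
Proof.
move=> h; rewrite /act.
have h1 : height_le H (if e then upd st i (behead (reg st i)) else st).
  by case: e => //; apply: behead_height.
case: eqP => _; first by move=> x; apply: leqW.
by move=> x; rewrite reg_upd; case: eqP => _ /=; rewrite ?ltnS // leqW.
Qed.

Lemma vstep_goes H st pc c : good_store k st -> height_le H st -> pc < size P ->
  wf_instr k (nth (Instr 0 false 0 id id) P pc) ->
  at_pos (state_at pc 0 0) (tape k st) 1 c ->
  goes machine c (4 * H + 5)
    (at_pos (state_at (vstep P pc st).1 0 0) (tape k (vstep P pc st).2) 1).
Proof.
move=> g h hpc [hi hj hp] ha.
set s := nth _ P pc in hi hj hp *.
have h1 : 2 * size (reg st (src s)) + 3 <= 2 * H + 3 by rewrite leq_add2r leq_mul2l h.
have -> : 4 * H + 5 = 2 * H + 3 + (2 * H + 2) by lia.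
apply: goes_trans (goes_le (pop_phase g hpc hi ha) h1) _.
set st1 := if _ then _ else _ => c1 ha1.
have g1 : good_store k st1 by rewrite /st1; case: ifP => // _; apply: behead_good.
have hs1 : height_le H st1 by rewrite /st1; case: ifP => // _; apply: behead_height.
apply: goes_le (push_phase g1 hpc hj (top_lt _ g) _ ha1) _; first exact/hp/top_lt.
by rewrite leq_add2r leq_mul2l hs1.
Qed.

(** An instruction raises a stack by at most one symbol, so all heights stay at most [H + n] and
    each instruction costs at most [4 * (H + n) + 5] steps: two passes over each of its two
    stacks. *)
Lemma vrun_goes n H st pc pc' st' c :
  (forall i, i < size P -> wf_instr k (nth (Instr 0 false 0 id id) P i)) ->
  good_store k st -> height_le H st -> vrun P n pc st pc' st' ->
  at_pos (state_at pc 0 0) (tape k st) 1 c ->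
  goes machine c (n * (4 * (H + n) + 5)) (at_pos (state_at pc' 0 0) (tape k st') 1).
Proof.
move=> wf; elim: n H st pc c => [|n IH] H st pc c g h /=.
  by move=> [-> ->]; apply: goes0.
case=> hpc hr ha; have [hi hj hp] := wf _ hpc.
have g1 : good_store k (vstep P pc st).2 by apply: act_good.
have hh : height_le H.+1 (vstep P pc st).2 by apply: act_height.
apply: (@goes_le _ _ (4 * H + 5 + n * (4 * (H.+1 + n) + 5))); last by nia.
apply: goes_trans (vstep_goes g h hpc (wf _ hpc) ha) _ => c1 ha1.
exact: IH g1 hh hr ha1.
Qed.

End Machine.

(** * Structured programs *)

Inductive cmd :=
| Op (i : nat) (e : bool) (j : nat) (g : nat -> nat)
| Seq (c1 c2 : cmd)
| If (i : nat) (p : pred nat) (c1 c2 : cmd)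
| While (i : nat) (p : pred nat) (c : cmd).

(* The last argument is an upper bound on the number of instructions executed. *)
Inductive exec : cmd -> seq (seq nat) -> seq (seq nat) -> nat -> Prop :=
| ExecOp i e j g st : exec (Op i e j g) st (act i e j g st) 1
| ExecSeq c1 c2 st st1 st2 t1 t2 :
    exec c1 st st1 t1 -> exec c2 st1 st2 t2 -> exec (Seq c1 c2) st st2 (t1 + t2)
| ExecIfT i (p : pred nat) c1 c2 st st' t :
    p (top st i) -> exec c1 st st' t -> exec (If i p c1 c2) st st' (t + 2)
| ExecIfF i (p : pred nat) c1 c2 st st' t :
    ~~ p (top st i) -> exec c2 st st' t -> exec (If i p c1 c2) st st' (t + 2)
| ExecWhileF i (p : pred nat) c st :
    ~~ p (top st i) -> exec (While i p c) st st 1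
| ExecWhileT i (p : pred nat) c st st1 st2 t1 t2 :
    p (top st i) -> exec c st st1 t1 -> exec (While i p c) st1 st2 t2 ->
    exec (While i p c) st st2 (t1 + t2 + 2)
| ExecLe c st st' t t' : exec c st st' t -> t <= t' -> exec c st st' t'.

Definition jump l := Instr 0 false 0 (fun _ => 0) (fun _ => l).
Definition branch i (p : pred nat) l1 l2 :=
  Instr i false i (fun _ => 0) (fun v => if p v then l1 else l2).

Fixpoint comp c pc : seq instr :=
  match c with
  | Op i e j g => [:: Instr i e j g (fun _ => pc.+1)]
  | Seq c1 c2 => comp c1 pc ++ comp c2 (pc + size (comp c1 pc))
  | If i p c1 c2 =>
      let l1 := comp c1 pc.+1 in
      let pc2 := (pc.+1 + size l1).+1 in
      let l2 := comp c2 pc2 in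
      branch i p pc.+1 pc2 :: l1 ++ jump (pc2 + size l2) :: l2
  | While i p c =>
      let l := comp c pc.+1 in
      branch i p pc.+1 (pc.+1 + size l).+1 :: l ++ [:: jump pc]
  end.

Fixpoint wf_cmd k c : Prop :=
  match c with
  | Op i e j g => [/\ i < k, j < k & forall v, v < 5 -> g v < 5]
  | Seq c1 c2 => wf_cmd k c1 /\ wf_cmd k c2
  | If i p c1 c2 => [/\ i < k, wf_cmd k c1 & wf_cmd k c2]
  | While i p c => i < k /\ wf_cmd k c
  end.

Notation instr0 := (Instr 0 false 0 id id).

Definition code_at P pc l :=
  pc + size l <= size P /\ forall i, i < size l -> nth instr0 P (pc + i) = nth instr0 l i.

Lemma code_at_cons P pc s l : code_at P pc (s :: l) ->
  [/\ pc < size P, nth instr0 P pc = s & code_at P pc.+1 l].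
Proof.
case=> /= h hn; split; first lia.
  by have := hn 0 isT; rewrite addn0.
by split=> [|i hi]; [lia | rewrite addSnnS hn].
Qed.

Lemma code_at_cat P pc l1 l2 : code_at P pc (l1 ++ l2) ->
  code_at P pc l1 /\ code_at P (pc + size l1) l2.
Proof.
case; rewrite size_cat => h hn; split; split; [lia | | lia |] => i hi.
  by rewrite hn ?nth_cat ?hi //; lia.
rewrite -addnA hn ?nth_cat; last lia.
by rewrite ltnNge leq_addr /= addKn.
Qed.

Lemma vrunD P n m pc st pc1 st1 pc2 st2 :
  vrun P n pc st pc1 st1 -> vrun P m pc1 st1 pc2 st2 -> vrun P (n + m) pc st pc2 st2.
Proof.
elim: n pc st => [|n IH] pc st /=; first by move=> [-> ->].
by move=> [h hr] hm; split => //; apply: IH hr hm.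
Qed.

Lemma vrun_step P pc st s : pc < size P -> nth instr0 P pc = s ->
  vrun P 1 pc st (next s (top st (src s))) (act (src s) (del s) (dst s) (put s) st).
Proof. by move=> h hs; rewrite /= /vstep hs. Qed.

Lemma vrun_branch P pc st i p l1 l2 : pc < size P ->
  nth instr0 P pc = branch i p l1 l2 ->
  vrun P 1 pc st (if p (top st i) then l1 else l2) st.
Proof. exact: vrun_step. Qed.

Lemma vrun_jump P pc st l : pc < size P -> nth instr0 P pc = jump l ->
  vrun P 1 pc st l st.
Proof. exact: vrun_step. Qed.

(** Induction on the execution. Jump targets are absolute and subprograms are compiled at shifted
    places, so the claim is made for every place of [P] where the code occurs. *)
Lemma comp_correct P c st st' t : exec c st st' t ->
  forall pc, code_at P pc (comp c pc) ->
  exists2 n, n <= t & vrun P n pc st (pc + size (comp c pc)) st'.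
Proof.
elim=> {c st st' t}.
- move=> i e j g st pc /= /code_at_cons[h hs _]; exists 1 => //.
  by have := vrun_step st h hs; rewrite addn1.
- move=> c1 c2 st st1 st2 t1 t2 _ IH1 _ IH2 pc /= /code_at_cat[/IH1 [n hn h1] /IH2[m hm h2]].
  exists (n + m); first exact: leq_add.
  by rewrite size_cat addnA; apply: vrunD h1 h2.
- move=> i p c1 c2 st st' t hp _ IH pc /= /code_at_cons[h hs].
  move=> /code_at_cat[/IH [n hn h1] /code_at_cons[h' hs' _]].
  exists (1 + n + 1); first lia.
  have := vrun_branch st h hs; rewrite hp => h0.
  have h2 := vrun_jump st' h' hs'.
  have := vrunD (vrunD h0 h1) h2; congr (vrun _ _ _ _ _ _); rewrite size_cat /=; lia.
- move=> i p c1 c2 st st' t hp _ IH pc /= /code_at_cons[h hs].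
  move=> /code_at_cat[_ /code_at_cons[_ _ /IH [n hn h1]]].
  exists (1 + n); first lia.
  have := vrun_branch st h hs; rewrite (negPf hp) => h0.
  have := vrunD h0 h1; congr (vrun _ _ _ _ _ _); rewrite size_cat /=; lia.
- move=> i p c st hp pc /= /code_at_cons[h hs _]; exists 1 => //.
  have := vrun_branch st h hs; rewrite (negPf hp).
  by congr (vrun _ _ _ _ _ _); rewrite size_cat /=; lia.
- move=> i p c st st1 st2 t1 t2 hp _ IH1 _ IH2 pc hc.
  have [m hm h3] := IH2 _ hc; move: hc => /= /code_at_cons[h hs].
  move=> /code_at_cat[/IH1 [n hn h1] /code_at_cons[h' hs' _]].
  have := vrun_branch st h hs; rewrite hp => h0.
  have h2 := vrun_jump st1 h' hs'.
  exists (1 + n + 1 + m); first lia.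
  exact: vrunD (vrunD (vrunD h0 h1) h2) h3.
- move=> c st st' t t' _ IH htt pc /IH[n hn hr]; exists n => //.
  exact: leq_trans htt.
Qed.

Definition wf_code k l := forall i, i < size l -> wf_instr k (nth instr0 l i).

Lemma wf_code_cat k l1 l2 : wf_code k l1 -> wf_code k l2 -> wf_code k (l1 ++ l2).
Proof.
move=> h1 h2 i; rewrite size_cat nth_cat => hi'; case: ltnP => hi; first exact: h1.
by apply: h2; lia.
Qed.

Lemma wf_code_cons k s l : wf_instr k s -> wf_code k l -> wf_code k (s :: l).
Proof. by move=> h1 h2 [|i] //= hi; apply: h2. Qed.

Lemma comp_wf k c pc : 0 < k -> wf_cmd k c -> wf_code k (comp c pc).
Proof.
move=> k0; elim: c pc => [i e j g|c1 IH1 c2 IH2|i p c1 IH1 c2 IH2|i p c IH] pc /=.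
- by move=> [hi hj hg]; apply: wf_code_cons.
- by move=> [h1 h2]; apply: wf_code_cat; auto.
- move=> [hi h1 h2]; apply: wf_code_cons; first by split.
  by apply: wf_code_cat; auto; apply: wf_code_cons; auto; split.
- move=> [hi h1]; apply: wf_code_cons; first by split.
  by apply: wf_code_cat; auto; apply: wf_code_cons; auto; split.
Qed.

Lemma vrun_inv k P n H pc st pc' st' :
  wf_code k P -> good_store k st -> height_le H st -> vrun P n pc st pc' st' ->
  good_store k st' /\ height_le (H + n) st'.
Proof.
move=> wf; elim: n H pc st => [|n IH] H pc st g h /=.
  by move=> [_ <-]; rewrite addn0.
case=> hpc hr; have [hi hj hp] := wf _ hpc; rewrite -addSnnS.
apply: IH hr; first exact: act_good.
exact: act_height.
Qed.

(** * A stack program followed by a given machine *)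

Definition word_store k (w : seq nat) := rev w :: nseq k.-1 [::].

Lemma reg_word k w i : reg (word_store k w) i = if i == 0 then rev w else [::].
Proof. by case: i => [|i] //; rewrite /reg /= nth_nseq if_same. Qed.

Lemma tape_word k w x : 0 < k ->
  tape k (word_store k w) x = if x is y.+1 then nth 0 w y else 0.
Proof.
move=> k0; case: x => [|y] //; rewrite /tape enc_single // => [|i i0].
  by rewrite reg_word /col revK.
by rewrite reg_word gtn_eqF // /col nth_nil.
Qed.

Lemma word_good k w : 0 < k -> all good_sym w -> good_store k (word_store k w).
Proof.
move=> k0 h; split; first by rewrite /= size_nseq prednK.
by rewrite /= all_rev h all_nseq orbT.
Qed.

Lemma init_at k w : 0 < k -> at_pos 0 (tape k (word_store k w)) 1 (init w).
Proof.
move=> k0; split => [|||j]; last by rewrite tape_word //; cells; case: w => *; rewrite nth_nil.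
all: case: w => //= [|a w] *; rewrite tape_word //= ?nth_nil //.
Qed.

(** When only stack 0 is nonempty the tape spells its word and the head is on the first cell, so one
    step of [glue] (the final [+ 1]) leaves [M] in its start configuration on [v], up to blanks. A
    leading 4 is the signal by which the program keeps [M] from running. The bound on the size of
    [v] is needed for the running time of [M]. *)
Lemma prelude k c M w v t : 0 < k -> wf_cmd k c -> all good_sym w ->
  exec c (word_store k w) (word_store k v) t ->
  size v <= size w + t /\
  exists2 t', t' <= t * (4 * (size w + t) + 5) + 1 &
    let c' := run (machine k (comp c 0) M) t' (init w) in
    (head 0 v != 4 -> conf_eq c' (lift_conf (init v))) /\
    (head 0 v = 4 ->
      [/\ halted (machine k (comp c 0) M) c', chead c' = One
        & tape_eq (cright c') (behead v)]).
Proof.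
move=> k0 wf hw hex; set P := comp c 0; set mach := machine k P M.
have wfP : wf_code k P by apply: comp_wf.
have hc : code_at P 0 (comp c 0) by split => [|i _]; rewrite add0n.
have [n hn hr] := comp_correct hex hc.
have g := word_good k0 hw.
have hh : height_le (size w) (word_store k w).
  by move=> i; rewrite reg_word; case: eqP; rewrite ?size_rev.
have [gv hv] := vrun_inv wfP g hh hr; rewrite add0n -/P in hr gv.
split.
  by have := hv 0; rewrite reg_word eqxx size_rev => /leq_trans; apply; lia.
have hgoes : goes mach (init w) (t * (4 * (size w + t) + 5) + 1) (fun c' =>
    (head 0 v != 4 -> conf_eq c' (lift_conf (init v))) /\
    (head 0 v = 4 -> [/\ halted mach c', chead c' = One & tape_eq (cright c') (behead v)])).
  apply: (@goes_le _ _ (n * (4 * (size w + n) + 5) + 1)); last by nia.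
  apply: goes_trans (vrun_goes M wfP g hh hr (init_at w k0)) _ => c1 ha.
  apply: goes_step ha (lookup_glue P M (tape_lt 1 gv)) _ _ => //.
  rewrite [pos_move _ _]/= tape_word // nth0 => c2 ha; apply: goes0.
  case: eqP ha => v4 [hq hhd hrt hlf]; split=> // h.
  - split.
    + by rewrite /halted /step hq lookup_halt.
    + by rewrite hhd /set_cell.
    + by move=> j; rewrite hrt /set_cell tape_word // nth_behead.
  - split => //=.
    + by rewrite hq; case: (v).
    + by rewrite hhd /set_cell eqxx; case: (v).
    + move=> j; rewrite hlf /set_cell tape_word //; cells; by case: (v) => *; rewrite /= nth_nil.
    + move=> j; rewrite hrt /set_cell tape_word //; case: (v) => //= *; by rewrite nth_nil.
by case: hgoes => t' ht h; exists t'.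
Qed.

(** * Polynomial time *)

(** An exact value and not an upper bound: coin numbers, sample numbers and thresholds must equal
    the intended function, and the machines compute them from the coefficients. *)
Definition is_poly (f : nat -> nat) := exists cs, forall n, poly_eval cs n = f n.

Lemma eq_is_poly f f' : f =1 f' -> is_poly f -> is_poly f'.
Proof. by move=> e [cs h]; exists cs => n; rewrite h. Qed.

Lemma is_poly_eval cs : is_poly (poly_eval cs).
Proof. by exists cs. Qed.

Lemma is_poly_const c : is_poly (fun=> c).
Proof. by exists [:: c] => n /=; rewrite muln0 addn0. Qed.

Lemma is_poly_id : is_poly id.
Proof. by exists [:: 0; 1] => n /=; rewrite muln0 addn0 muln1. Qed.

Lemma is_poly_add f g : is_poly f -> is_poly g -> is_poly (fun n => f n + g n).
Proof.
move=> [a ha] [b hb].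
suff [cs h] : exists cs, forall n, poly_eval cs n = poly_eval a n + poly_eval b n.
  by exists cs => n; rewrite h ha hb.
elim: a b {ha hb} => [|x a IH] [|y b]; [by exists [::] | by exists (y :: b) | |].
  by exists (x :: a) => n; rewrite addn0.
by have [cs h] := IH b; exists (x + y :: cs) => n /=; rewrite h; lia.
Qed.

Lemma is_poly_mulX f : is_poly f -> is_poly (fun n => n * f n).
Proof. by move=> [a ha]; exists (0 :: a) => n /=; rewrite ha. Qed.

Lemma is_poly_mul f g : is_poly f -> is_poly g -> is_poly (fun n => f n * g n).
Proof.
move=> [a ha] hg; apply: (eq_is_poly (f := fun n => poly_eval a n * g n)) => [n|].
  by rewrite ha.
elim: a {ha} => [|x a IH]; first exact: is_poly_const.
have hx : is_poly (fun n => x * g n).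
  elim: x => [|x IHx]; first exact: is_poly_const.
  by apply: eq_is_poly (is_poly_add hg IHx) => n; rewrite mulSn.
by apply: eq_is_poly (is_poly_add hx (is_poly_mulX IH)) => n /=; rewrite mulnDl mulnA.
Qed.

Lemma is_poly_comp f g : is_poly f -> is_poly g -> is_poly (fun n => f (g n)).
Proof.
move=> [a ha] hg; apply: (eq_is_poly (f := fun n => poly_eval a (g n))) => [n|].
  by rewrite ha.
elim: a {ha} => [|x a IH]; first exact: is_poly_const.
exact: is_poly_add (is_poly_const x) (is_poly_mul hg IH).
Qed.

Lemma poly_eval_mono cs : {homo poly_eval cs : m n / m <= n}.
Proof. by move=> m n h; elim: cs => //= c cs IH; rewrite leq_add2l leq_mul. Qed.

Ltac is_poly := repeat first
  [ exact: is_poly_id | exact: is_poly_eval | exact: is_poly_const | assumption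
  | apply: is_poly_add | apply: is_poly_mul | (apply: is_poly_comp; first exact: is_poly_eval) ].

Lemma input_good w : input_word w -> all good_sym w.
Proof.
by apply: sub_all => a /orP[/orP[]|] /eqP->.
Qed.

Lemma input_head w : input_word w -> head 0 w != 4.
Proof. by case: w => //= a w /andP[/orP[/orP[]|] /eqP->]. Qed.

(** [T] instructions on stacks of height at most [n + T n], one step of [glue], then [M] on a word
    of length at most [n + T n]. A halted configuration no longer changes, so the output may be read
    at this common time bound. *)
Theorem exec_then_machine k c M tM f T : 0 < k -> wf_cmd k c -> poly_time M tM -> is_poly T ->
  (forall w, input_word w -> exec c (word_store k w) (word_store k (f w)) (T (size w))) ->
  (forall w, input_word w -> input_word (f w) \/ head 0 (f w) = 4) ->
  exists M' tM', poly_time M' tM' /\ forall w, input_word w ->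
    (input_word (f w) -> conf_eq (output M' tM' w) (lift_conf (output M tM (f w)))) /\
    (head 0 (f w) = 4 ->
       chead (output M' tM' w) = One /\ tape_eq (cright (output M' tM' w)) (behead (f w))).
Proof.
move=> k0 wf hM hT hex hf.
have [cs hcs] : is_poly (fun n => T n * (4 * (n + T n) + 5) + 1 + poly_eval tM (n + T n)).
  by is_poly.
set mach := machine k (comp c 0) M.
have key w : input_word w -> halted mach (output mach cs w) /\
    ((input_word (f w) -> conf_eq (output mach cs w) (lift_conf (output M tM (f w)))) /\
    (head 0 (f w) = 4 ->
       chead (output mach cs w) = One /\ tape_eq (cright (output mach cs w)) (behead (f w)))).
  move=> hw; have [hs [t' ht /= [h1 h2]]] := prelude M k0 wf (input_good hw) (hex w hw).
  rewrite /output hcs; case: (hf w hw) => hfw.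
    have {h2}ce := run_conf_eq mach (poly_eval tM (size (f w))) (h1 (input_head hfw)).
    rewrite -runD run_lift in ce.
    have hh : halted mach (run mach (t' + poly_eval tM (size (f w))) (init w)).
      by rewrite (halted_conf_eq _ ce) halted_lift hM.
    rewrite (run_halted hh); last by rewrite leq_add // poly_eval_mono.
    split=> //; split=> // h; have := input_head hfw.
    by rewrite h.
  have [hh ho hr] := h2 hfw.
  rewrite (run_halted hh); last by rewrite (leq_trans ht) // leq_addr.
  by split=> //; split=> // /input_head; rewrite hfw.
by exists mach, cs; split=> w /key [].
Qed.

(** * Unary arithmetic on stacks *)

Definition nonblank : pred nat := fun v => v != 0.
Definition mov i j := Op i true j id.
Definition pop i := Op i true i (fun _ => 0).
Definition push i a := Op i false i (fun _ => a).
Definition move_all i j := While i nonblank (mov i j).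
Definition clear i := While i nonblank (pop i).

Lemma exec_eq c st st' st'' t : exec c st st' t -> st' = st'' -> exec c st st'' t.
Proof. by move=> h <-. Qed.

Lemma store_eq (st st' : seq (seq nat)) : size st = size st' -> reg st =1 reg st' -> st = st'.
Proof. by move=> hs h; apply: (@eq_from_nth _ [::]) => // i _; apply: h. Qed.

Lemma size_upd (st : seq (seq nat)) i l : i < size st -> size (upd st i l) = size st.
Proof. by move=> h; rewrite size_set_nth; apply/maxn_idPr. Qed.

Ltac store := apply: store_eq; [by rewrite ?size_set_nth; lia
  | move=> ?; rewrite !reg_upd; repeat (case: eqP => ?); subst;
    try (match goal with H : is_true (?b != ?b) |- _ => by rewrite eqxx in H end);
    rewrite ?rev_cons ?cat_rcons //; try congruence].

(** The symbols moved must be nonblank, since an instruction that computes 0 pushes nothing. *)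
Lemma exec_move p i j l1 l2 st : i != j -> i < size st -> j < size st ->
  reg st i = l1 ++ l2 -> all nonblank l1 -> all p l1 -> ~~ p (head 0 l2) ->
  exec (While i p (mov i j)) st
    (upd (upd st i l2) j (rev l1 ++ reg st j)) (3 * size l1 + 1).
Proof.
move=> ij hi hj; elim: l1 st hi hj => [|a l1 IH] st hi hj.
  move=> /= e _ _ p0; apply: exec_eq; first by apply: ExecWhileF; rewrite /top e.
  by store.
move=> e /= /andP[a0 nz1] /andP[pa p1] p2.
have -> : 3 * (size l1).+1 + 1 = 1 + (3 * size l1 + 1) + 2 by lia.
have hact : exec (mov i j) st (upd (upd st i (l1 ++ l2)) j (a :: reg st j)) 1.
  apply: exec_eq; first exact: ExecOp.
  by rewrite /act e /= (negPf a0) reg_upd eq_sym (negPf ij).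
apply: ExecWhileT hact _; first by rewrite /top e.
apply: exec_eq; first apply: IH; rewrite ?size_upd ?reg_upd ?eqxx ?(negPf ij) //.
by store.
Qed.

Lemma exec_move_all i j st : i != j -> i < size st -> j < size st ->
  all nonblank (reg st i) ->
  exec (move_all i j) st
    (upd (upd st i [::]) j (rev (reg st i) ++ reg st j)) (3 * size (reg st i) + 1).
Proof. by move=> ij hi hj h; apply: exec_move; rewrite ?cats0. Qed.

Lemma exec_clear i st : i < size st -> all nonblank (reg st i) ->
  exec (clear i) st (upd st i [::]) (3 * size (reg st i) + 1).
Proof.
move E : (reg st i) => l; elim: l st E => [|a l IH] st e hi /=.
  move=> _; apply: exec_eq; first by apply: ExecWhileF; rewrite /top e.
  by store.
move=> /andP[a0 hl].
have -> : 3 * (size l).+1 + 1 = 1 + (3 * size l + 1) + 2 by lia.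
have hact : exec (pop i) st (upd st i l) 1.
  by apply: exec_eq; first exact: ExecOp; rewrite /act e.
apply: ExecWhileT hact _; first by rewrite /top e.
apply: exec_eq; first apply: IH; rewrite ?size_upd ?reg_upd ?eqxx //.
by store.
Qed.

(** Once stack [a] is exhausted, [mov] has no effect while the counter keeps decreasing; so [n] may
    exceed its height, in agreement with [take] and [drop]. *)
Lemma exec_move_count i a b n st :
  i != a -> i != b -> a != b -> i < size st -> a < size st -> b < size st ->
  reg st i = nseq n One -> all nonblank (reg st a) ->
  exec (While i nonblank (Seq (pop i) (mov a b))) st
    (upd (upd (upd st i [::]) a (drop n (reg st a))) b
      (rev (take n (reg st a)) ++ reg st b)) (4 * n + 1).
Proof.
move=> ia ib ab hi ha hb; elim: n st hi ha hb => [|n IH] st hi ha hb.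
  move=> e _; apply: exec_eq; first by apply: ExecWhileF; rewrite /top e.
  by rewrite drop0 take0; store.
move=> e hnz; have -> : 4 * n.+1 + 1 = (1 + 1) + (4 * n + 1) + 2 by lia.
pose st1 := upd st i (nseq n One).
have h1 : exec (pop i) st st1 1.
  by apply: exec_eq; first exact: ExecOp; rewrite /act e.
have h2 : exec (mov a b) st1
    (upd (upd st1 a (drop 1 (reg st a))) b (rev (take 1 (reg st a)) ++ reg st b)) 1.
  apply: exec_eq; first exact: ExecOp.
  rewrite /act /st1 reg_upd (eq_sym a i) (negPf ia); case E: (reg st a) hnz => [|x l] /=.
    by move=> _; store.
  move=> /andP[x0 _]; rewrite (negPf x0) !reg_upd (eq_sym b) (negPf ab).
  by rewrite (eq_sym b) (negPf ib) drop0 take0.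
apply: ExecWhileT (ExecSeq h1 h2) _; first by rewrite /top e.
have h3 : all nonblank (drop 1 (reg st a)) by case: (reg st a) hnz => //= ? ? /andP[_]; rewrite drop0.
apply: exec_eq; first apply: IH.
all: try (by rewrite /st1 ?size_set_nth; lia).
- by rewrite !reg_upd (negPf ia) (negPf ib) eqxx.
- by rewrite !reg_upd (negPf ab) eqxx.
rewrite /st1 !reg_upd !eqxx (negPf ab).
case: (reg st a) => [|x l] /=; rewrite ?drop0 ?take0 /=; store.
Qed.

Definition skip := Op 0 false 0 (fun _ => 0).

Lemma exec_skip st : exec skip st st 1.
Proof. exact: ExecOp. Qed.

(** The multiplication step of Horner's rule in unary: for each unit of stack 5, stack 2 is added to
    the accumulator 4 and restored by way of stack 3. *)
Definition mul_cmd :=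
  Seq (While 5 nonblank (Seq (pop 5) (Seq (While 2 nonblank (Seq (mov 2 3) (push 4 One)))
    (move_all 3 2)))) (move_all 4 5).

Fixpoint horner cs :=
  if cs is c :: cs' then
    Seq (Seq (horner cs') mul_cmd) (iter c (fun p => Seq p (push 5 One)) skip)
  else skip.

Lemma nseq_cat T (x : T) m n : nseq m x ++ nseq n x = nseq (m + n) x.
Proof. by rewrite nseqD. Qed.

Lemma all_nonblank_nseq n : all nonblank (nseq n One).
Proof. by rewrite all_nseq orbT. Qed.

Lemma exec_mul n m a0 a1 tl :
  exec mul_cmd [:: a0, a1, nseq n One, [::], [::], nseq m One & tl]
    [:: a0, a1, nseq n One, [::], [::], nseq (n * m) One & tl]
    (m * (7 * n + 5) + 1 + (3 * (n * m) + 1)).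
Proof.
have copy x y z a5 : exec (While 2 nonblank (Seq (mov 2 3) (push 4 One)))
    [:: a0, a1, nseq x One, nseq y One, nseq z One, a5 & tl]
    [:: a0, a1, [::], nseq (x + y) One, nseq (x + z) One, a5 & tl] (4 * x + 1).
  elim: x y z => [|x IH] y z; first exact: ExecWhileF.
  have -> : 4 * x.+1 + 1 = (1 + 1) + (4 * x + 1) + 2 by lia.
  apply: ExecWhileT (ExecSeq (ExecOp _ _ _ _ _) (ExecOp _ _ _ _ _)) _ => //.
  by have := IH y.+1 z.+1; rewrite !addnS.
have loop z : exec (While 5 nonblank (Seq (pop 5) (Seq (While 2 nonblank (Seq (mov 2 3) (push 4 One)))
    (move_all 3 2)))) [:: a0, a1, nseq n One, [::], nseq z One, nseq m One & tl]
    [:: a0, a1, nseq n One, [::], nseq (n * m + z) One, [::] & tl] (m * (7 * n + 5) + 1).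
  elim: m z => [|m' IH] z; first by rewrite muln0; apply: ExecWhileF.
  have -> : m'.+1 * (7 * n + 5) + 1 =
    (1 + (4 * n + 1 + (3 * n + 1))) + (m' * (7 * n + 5) + 1) + 2 by lia.
  have -> : n * m'.+1 + z = n * m' + (n + z) by rewrite mulnS; lia.
  apply: ExecWhileT (IH (n + z)) => //.
  apply: ExecSeq; first exact: ExecOp.
  apply: ExecSeq; first exact: (copy n 0 z (nseq m' One)).
  rewrite addn0; apply: exec_eq.
    have := @exec_move_all 3 2 [:: a0, a1, [::], nseq n One, nseq (n + z) One, nseq m' One & tl].
    by rewrite /reg /= size_nseq; apply => //; apply: all_nonblank_nseq.
  by rewrite /= rev_nseq cats0.
apply: ExecSeq; first by have := loop 0; rewrite addn0; apply.
apply: exec_eq.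
  have := @exec_move_all 4 5 [:: a0, a1, nseq n One, [::], nseq (n * m) One, [::] & tl].
  by rewrite /reg /= size_nseq; apply => //; apply: all_nonblank_nseq.
by rewrite /= rev_nseq cats0.
Qed.

Fixpoint horner_cost cs n :=
  if cs is c :: cs' then
    horner_cost cs' n + (poly_eval cs' n * (7 * n + 5) + 1 + (3 * (n * poly_eval cs' n) + 1))
    + c.+1
  else 1.

Lemma is_poly_horner_cost cs : is_poly (horner_cost cs).
Proof. by elim: cs => [|c cs IH] /=; is_poly. Qed.

Lemma exec_horner cs n a0 a1 tl :
  exec (horner cs) [:: a0, a1, nseq n One, [::], [::], [::] & tl]
    [:: a0, a1, nseq n One, [::], [::], nseq (poly_eval cs n) One & tl] (horner_cost cs n).
Proof.
elim: cs => [|c cs IH] /=; first exact: exec_skip.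
apply: ExecSeq; first by apply: ExecSeq IH (exec_mul _ _ _ _ _).
elim: c => [|c IHc] /=; first exact: exec_skip.
have -> : c.+2 = c.+1 + 1 by lia.
by apply: ExecSeq IHc _; apply: exec_eq; first exact: ExecOp.
Qed.

Lemma wf_horner k cs : 5 < k -> wf_cmd k (horner cs).
Proof.
move=> h; elim: cs => [|c cs IH] /=; first by split; [lia | lia |].
split; first by do !split=> //=; lia.
by elim: c => [|c IHc] /=; [split | split => //; split]; try lia.
Qed.

(** * The modified sampler *)

Definition field (w : seq nat) := take (find (fun a => ~~ is_bit a) w) w.
Definition unfield (w : seq nat) := drop (find (fun a => ~~ is_bit a) w) w.

Lemma field_cat w : field w ++ unfield w = w.
Proof. exact: cat_take_drop. Qed.

Lemma field_bits w : all is_bit (field w).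
Proof. by rewrite /field; elim: w => //= a w IH; case E: (is_bit a); rewrite /= ?E ?IH. Qed.

Lemma unfield_head w : ~~ is_bit (head 0 (unfield w)).
Proof.
by rewrite /unfield; elim: w => //= a w IH; case E: (is_bit a) => //=; rewrite E.
Qed.

Lemma field_sep x w : all is_bit x -> field (x ++ Sep :: w) = x.
Proof. by rewrite /field; elim: x => //= a x IH /andP[-> /IH] /= ->. Qed.

Lemma unfield_sep x w : all is_bit x -> unfield (x ++ Sep :: w) = Sep :: w.
Proof. by rewrite /unfield; elim: x => //= a x IH /andP[-> /IH] /= ->. Qed.

Lemma bits_nonblank w : all is_bit w -> all nonblank w.
Proof. by apply: sub_all => a /orP[] /eqP->. Qed.

Lemma bits_input w : all is_bit w -> input_word w.
Proof. by apply: sub_all => a /orP[] /eqP->. Qed.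

Lemma input_nonblank w : input_word w -> all nonblank w.
Proof. by apply: sub_all => a /orP[/orP[]|] /eqP->. Qed.

Lemma input_cat w w' : input_word (w ++ w') = input_word w && input_word w'.
Proof. exact: all_cat. Qed.

Lemma input_take n w : input_word w -> input_word (take n w).
Proof. by rewrite -{1}(cat_take_drop n w) input_cat => /andP[]. Qed.

Lemma input_drop n w : input_word w -> input_word (drop n w).
Proof. by rewrite -{1}(cat_take_drop n w) input_cat => /andP[]. Qed.

Lemma input_behead w : input_word w -> input_word (behead w).
Proof. by case: w => //= a w /andP[]. Qed.

Definition count_move := While 1 is_bit (Seq (push 2 One) (mov 1 0)).

Lemma exec_count_move l1 l2 o m tl : all is_bit l1 -> ~~ is_bit (head 0 l2) ->
  exec count_move [:: o, l1 ++ l2, nseq m One & tl]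
    [:: rev l1 ++ o, l2, nseq (size l1 + m) One & tl] (4 * size l1 + 1).
Proof.
elim: l1 o m => [|a l1 IH] o m /= h1 h2; first exact: ExecWhileF.
case/andP: h1 => ha h1; have -> : 4 * (size l1).+1 + 1 = (1 + 1) + (4 * size l1 + 1) + 2 by lia.
have a0 : a == 0 = false by case/orP: ha => /eqP->.
apply: ExecWhileT => //.
  apply: ExecSeq; first exact: ExecOp.
  by apply: exec_eq; first exact: ExecOp; rewrite /act /= a0.
by have := IH (a :: o) m.+1 h1 h2; rewrite addnS rev_cons cat_rcons.
Qed.

(* Stacks: 0 input and output, 1 unread input, 2 the unary size parameter,
   3 and 4 scratch, 5 the number of coins of the original sampler.  The symbol 4
   at the head of the result marks a string of random bits. *)
Definition sampler_cmd qs :=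
  Seq (move_all 0 1) (Seq count_move (Seq (pop 1) (Seq (push 0 Sep)
  (Seq (horner qs) (Seq (While 5 nonblank (Seq (pop 5) (mov 1 0)))
  (Seq (If 1 (pred1 One)
         (Seq (pop 1) (Seq (clear 0) (Seq (push 0 4) (move_all 1 0))))
         (clear 1))
  (clear 2))))))).

Definition sampler_fun qs w :=
  let x := field w in let r := behead (unfield w) in
  let q := poly_eval qs (size x) in
  if head 0 (drop q r) == One then 4 :: behead (drop q r) else x ++ Sep :: take q r.

Lemma exec_sampler qs w : input_word w ->
  exec (sampler_cmd qs) (word_store 6 w) (word_store 6 (sampler_fun qs w))
    (20 * size w + 40 + horner_cost qs (size (field w)) + 4 * poly_eval qs (size (field w))).
Proof.
move=> hw; set x := field w; set r := behead (unfield w).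
set q := poly_eval qs (size x).
have hx : all is_bit x by apply: field_bits.
have hu : input_word (unfield w) by apply: input_drop.
have hr : input_word r by apply: input_behead.
have sw : size x + size (unfield w) = size w by rewrite -size_cat field_cat.
have sr : size r <= size (unfield w) by rewrite size_behead leq_pred.
have e1 : exec (move_all 0 1) (word_store 6 w) [:: [::]; w; [::]; [::]; [::]; [::]] (3 * size w + 1).
  apply: exec_eq; first by rewrite -(size_rev w); apply: exec_move_all => //; rewrite all_rev input_nonblank.
  by rewrite /= /reg /= revK cats0.
have e2 : exec count_move [:: [::]; w; [::]; [::]; [::]; [::]]
    [:: rev x; unfield w; nseq (size x) One; [::]; [::]; [::]] (4 * size x + 1).
  have := @exec_count_move x (unfield w) [::] 0 [:: [::]; [::]; [::]] hx (unfield_head w).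
  by rewrite field_cat cats0 addn0.
have e3 : exec (pop 1) [:: rev x; unfield w; nseq (size x) One; [::]; [::]; [::]]
   [:: rev x; r; nseq (size x) One; [::]; [::]; [::]] 1 by apply: ExecOp.
have e4 : exec (push 0 Sep) [:: rev x; r; nseq (size x) One; [::]; [::]; [::]]
   [:: Sep :: rev x; r; nseq (size x) One; [::]; [::]; [::]] 1 by apply: ExecOp.
have e5 := exec_horner qs (size x) (Sep :: rev x) r [::].
have e6 : exec (While 5 nonblank (Seq (pop 5) (mov 1 0)))
   [:: Sep :: rev x; r; nseq (size x) One; [::]; [::]; nseq q One]
   [:: rev (take q r) ++ Sep :: rev x; drop q r; nseq (size x) One; [::]; [::]; [::]] (4 * q + 1).
  exact: (@exec_move_count 5 1 0 q [:: Sep :: rev x; r; nseq (size x) One; [::]; [::]; nseq q One]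
    isT isT isT isT isT isT erefl (input_nonblank hr)).
have so : size (rev (take q r) ++ Sep :: rev x) <= size r + size x + 1.
  rewrite size_cat /= !size_rev size_take; case: ltnP; lia.
have hd : all nonblank (drop q r) by rewrite input_nonblank // input_drop.
have sd : size (drop q r) <= size r by rewrite size_drop leq_subr.
have e7 : exec (If 1 (pred1 One)
         (Seq (pop 1) (Seq (clear 0) (Seq (push 0 4) (move_all 1 0)))) (clear 1))
   [:: rev (take q r) ++ Sep :: rev x; drop q r; nseq (size x) One; [::]; [::]; [::]]
   [:: rev (sampler_fun qs w); [::]; nseq (size x) One; [::]; [::]; [::]]
   (3 * size w + 6 + 3 * size w + 4).
  rewrite /sampler_fun -/x -/r -/q; case: ifP => hd1.
    apply: (@ExecLe _ _ _ ((1 + ((3 * size (rev (take q r) ++ Sep :: rev x) + 1)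
       + (1 + (3 * size (behead (drop q r)) + 1)))) + 2)); last by rewrite size_behead; lia.
    apply: ExecIfT => //; apply: ExecSeq; first exact: ExecOp.
    apply: ExecSeq.
      apply: exec_clear => //; rewrite /= /reg /= all_cat /= !all_rev.
      by rewrite (bits_nonblank hx) input_nonblank // input_take.
    apply: ExecSeq; first exact: ExecOp.
    apply: exec_eq; first apply: exec_move_all => //.
      by rewrite /reg /=; case: (drop q r) hd => //= ? ? /andP[].
    by rewrite /= /reg /= rev_cons cats1.
  apply: (@ExecLe _ _ _ (3 * size (drop q r) + 1 + 2)); last by lia.
  apply: ExecIfF; first by rewrite /= /top /reg /= hd1.
  apply: exec_eq; first exact: exec_clear.
  by rewrite /= rev_cat rev_cons cat_rcons.
have e8 : exec (clear 2) [:: rev (sampler_fun qs w); [::]; nseq (size x) One; [::]; [::]; [::]]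
   (word_store 6 (sampler_fun qs w)) (3 * size x + 1).
  apply: exec_eq.
    have := @exec_clear 2 [:: rev (sampler_fun qs w); [::]; nseq (size x) One; [::]; [::]; [::]] isT.
    by rewrite /reg /= size_nseq; apply; apply: all_nonblank_nseq.
  by [].
apply: ExecLe.
  exact: ExecSeq e1 (ExecSeq e2 (ExecSeq e3 (ExecSeq e4 (ExecSeq e5 (ExecSeq e6 (ExecSeq e7 e8)))))).
by rewrite -/q; lia.
Qed.

Lemma wf_sampler qs : wf_cmd 6 (sampler_cmd qs).
Proof. by have := @wf_horner 6 qs isT; do !split. Qed.

Lemma sampler_input qs w : input_word w ->
  input_word (sampler_fun qs w) \/ head 0 (sampler_fun qs w) = 4.
Proof.
move=> hw; rewrite /sampler_fun; case: ifP => _; [by right | left].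
rewrite input_cat (bits_input (field_bits w)) /=.
by apply: input_take; apply: input_behead; apply: input_drop.
Qed.

(** * Selection of the samples and the coins *)

(* Stacks 0 to 4 as in the sampler; 5 the number of samples still wanted,
   6 the number of coins, 7 the least length of a random string, 8 the part of 7
   already matched by the current sample, 9 the current sample, 10 the first
   random string.  The stacks 5 to 8 are unary. *)
Definition measure_cmd := While 1 is_bit (Seq (mov 1 9) (mov 7 8)).
(** Stack 9 has the last bit of the sample on top, as the output stack requires; one transfer would
    reverse it, hence the detour through stack 3. The single transfer to stack 10 in [body_cmd] is
    intended: there the first bit must be on top, where it is read. *)
Definition keep_cmd :=
  Seq (pop 5) (Seq (move_all 9 3) (Seq (move_all 3 0)
    (Seq (push 0 Sep) (Seq (mov 1 0) (push 0 Sep))))).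
(** Each bit of the sample takes a unit off stack 7, so afterwards this stack is nonempty exactly
    when the sample is shorter than the threshold. Stack 8 collects the units and gives them
    back. *)
Definition body_cmd :=
  Seq measure_cmd (Seq (pop 1) (Seq
    (If 7 nonblank (If 5 nonblank keep_cmd (Seq (clear 9) (pop 1)))
             (Seq (pop 1) (If 10 nonblank (clear 9) (move_all 9 10))))
    (Seq (pop 1) (move_all 8 7)))).

(* [m] is fuel; [r] is empty until a random string has been seen. *)
Fixpoint select l m (i out : seq nat) s (r : seq nat) : seq nat * seq nat :=
  if m isn't m'.+1 then (out, r) else
  if i is [::] then (out, r) else
  let y := field i in
  let i1 := behead (unfield i) in
  if l <= size y then select l m' (drop 2 i1) out s (if r is [::] then y else r)
  else if s is s'.+1 then
    select l m' (drop 2 i1) (out ++ y ++ Sep :: take 1 i1 ++ [:: Sep]) s' r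
  else select l m' (drop 2 i1) out s r.

Lemma exec_measure l1 l2 a b o n t1 t2 s p y tl : all is_bit l1 -> ~~ is_bit (head 0 l2) ->
  exec measure_cmd
    [:: o, l1 ++ l2, n, t1, t2, s, p, nseq a One, nseq b One, y & tl]
    [:: o, l2, n, t1, t2, s, p, nseq (a - size l1) One,
        nseq (minn a (size l1) + b) One, rev l1 ++ y & tl] (4 * size l1 + 1).
Proof.
elim: l1 a b y => [|c l1 IH] a b y /= h1 h2.
  by rewrite subn0 minn0; apply: ExecWhileF.
case/andP: h1 => hc h1; have -> : 4 * (size l1).+1 + 1 = (1 + 1) + (4 * size l1 + 1) + 2 by lia.
have c0 : c == 0 = false by case/orP: hc => /eqP->.
have hm : exec (mov 1 9) [:: o, c :: l1 ++ l2, n, t1, t2, s, p, nseq a One, nseq b One, y & tl]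
   [:: o, l1 ++ l2, n, t1, t2, s, p, nseq a One, nseq b One, c :: y & tl] 1.
  by apply: exec_eq; first exact: ExecOp; rewrite /act /= c0.
rewrite rev_cons cat_rcons.
case: a hm => [|a] hm.
  apply: ExecWhileT => //; first by apply: ExecSeq hm (ExecOp _ _ _ _ _).
  by have := IH 0 b (c :: y) h1 h2; rewrite !sub0n !min0n.
apply: ExecWhileT => //; first by apply: ExecSeq hm (ExecOp _ _ _ _ _).
by have := IH a b.+1 (c :: y) h1 h2; rewrite subSS minnSS addSnnS.
Qed.

Lemma exec_body l i out n s p r :
  input_word i -> all nonblank r -> i != [::] ->
  let y := field i in let i1 := behead (unfield i) in
  exec body_cmd
    [:: rev out; i; n; [::]; [::]; nseq s One; p; nseq l One; [::]; [::]; r]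
    (if l <= size y then
       [:: rev out; drop 2 i1; n; [::]; [::]; nseq s One; p; nseq l One; [::]; [::];
           if r is [::] then y else r]
     else if s is s'.+1 then
       [:: rev (out ++ y ++ Sep :: take 1 i1 ++ [:: Sep]); drop 2 i1; n; [::]; [::];
           nseq s' One; p; nseq l One; [::]; [::]; r]
     else [:: rev out; drop 2 i1; n; [::]; [::]; nseq s One; p; nseq l One; [::]; [::]; r])
    (13 * size i + 25).
Proof.
move=> hi hr i0 y i1.
have hy : all is_bit y by apply: field_bits.
have hi1 : input_word i1 by apply/input_behead/input_drop.
have sy : size y <= size i by rewrite -[X in _ <= size X](field_cat i) size_cat leq_addr.
have e1 : exec measure_cmd
    [:: rev out; i; n; [::]; [::]; nseq s One; p; nseq l One; [::]; [::]; r]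
    [:: rev out; unfield i; n; [::]; [::]; nseq s One; p; nseq (l - size y) One;
        nseq (minn l (size y)) One; rev y; r] (4 * size y + 1).
  have := @exec_measure y (unfield i) l 0 (rev out) n [::] [::] (nseq s One) p [::] [:: r] hy.
  by rewrite field_cat addn0 cats0; apply; apply: unfield_head.
have e2 : exec (pop 1) [:: rev out; unfield i; n; [::]; [::]; nseq s One; p; nseq (l - size y) One;
        nseq (minn l (size y)) One; rev y; r]
   [:: rev out; i1; n; [::]; [::]; nseq s One; p; nseq (l - size y) One;
        nseq (minn l (size y)) One; rev y; r] 1 by apply: ExecOp.
have hny : all nonblank (rev y) by rewrite all_rev bits_nonblank.
pose o' s' := if l <= size y then rev out else if s' is _.+1 then
  rev (out ++ y ++ Sep :: take 1 i1 ++ [:: Sep]) else rev out.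
pose r' := if l <= size y then (if r is [::] then y else r) else r.
pose s' := if l <= size y then s else s.-1.
have e3 : exec (If 7 nonblank (If 5 nonblank keep_cmd (Seq (clear 9) (pop 1)))
             (Seq (pop 1) (If 10 nonblank (clear 9) (move_all 9 10))))
   [:: rev out; i1; n; [::]; [::]; nseq s One; p; nseq (l - size y) One;
        nseq (minn l (size y)) One; rev y; r]
   [:: o' s; behead i1; n; [::]; [::]; nseq s' One; p; nseq (l - size y) One;
        nseq (minn l (size y)) One; [::]; r'] (6 * size y + 12).
  rewrite /o' /r' /s'; case: leqP => hl.
    apply: (@ExecLe _ _ _ (1 + (3 * size y + 1 + 2) + 2)); last by lia.
    apply: ExecIfF; first by rewrite /top /reg /= (eqP hl).
    apply: ExecSeq; first exact: ExecOp.
    case: r hr {e1 e2 r'} => [|x r] /= hr.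
      apply: ExecIfF => //; apply: (@ExecLe _ _ _ (3 * size (rev y) + 1)); last by rewrite size_rev.
      apply: exec_eq; first exact: exec_move_all.
      by rewrite /= /reg /= revK cats0.
    apply: ExecIfT; first by case/andP: hr.
    apply: (@ExecLe _ _ _ (3 * size (rev y) + 1)); last by rewrite size_rev.
    by apply: exec_eq; first exact: exec_clear.
  have -> : 6 * size y + 12 = (6 * size y + 10) + 2 by lia.
  apply: ExecIfT; first by rewrite /top /reg /=; case: (l - size y) (subn_gt0 (size y) l) => //; rewrite hl.
  have -> : 6 * size y + 10 = (6 * size y + 8) + 2 by lia.
  case: s {e1 e2 s'} => [|s'] /=.
    apply: ExecIfF => //; apply: (@ExecLe _ _ _ (3 * size y + 1 + 1)); last by lia.
    have hs := size_rev y; apply: ExecSeq.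
      by apply: (@ExecLe _ _ _ (3 * size (rev y) + 1)); [apply: exec_clear | rewrite hs].
    exact: ExecOp.
  apply: ExecIfT => //.
  apply: (@ExecLe _ _ _ (1 + ((3 * size y + 1) + ((3 * size y + 1) + (1 + (1 + 1)))))); last by lia.
  apply: ExecSeq; first exact: ExecOp.
  apply: ExecSeq.
    by apply: (@ExecLe _ _ _ (3 * size (rev y) + 1)); [apply: exec_move_all | rewrite size_rev].
  rewrite /= /reg /= revK cats0; apply: ExecSeq.
    by apply: exec_move_all => //; rewrite bits_nonblank.
  rewrite /= /reg /=; apply: ExecSeq; first exact: ExecOp.
  apply: ExecSeq; first exact: ExecOp.
  apply: exec_eq; first exact: ExecOp.
  rewrite /act /reg /top /=.
  case: (i1) hi1 => [|x i2] /=; first by rewrite !rev_cat -catA.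
  case/andP=> hx _; have x0 : x == 0 = false by case/orP: hx => [/orP[]|] /eqP->.
  by rewrite x0 take0 !rev_cat -catA.
have e4 : exec (pop 1)
   [:: o' s; behead i1; n; [::]; [::]; nseq s' One; p; nseq (l - size y) One;
        nseq (minn l (size y)) One; [::]; r']
   [:: o' s; drop 2 i1; n; [::]; [::]; nseq s' One; p; nseq (l - size y) One;
        nseq (minn l (size y)) One; [::]; r'] 1.
  apply: exec_eq; first exact: ExecOp.
  by case: (i1) => [|? [|? ?]] //=; rewrite drop0.
have e5 : exec (move_all 8 7)
   [:: o' s; drop 2 i1; n; [::]; [::]; nseq s' One; p; nseq (l - size y) One;
        nseq (minn l (size y)) One; [::]; r']
   [:: o' s; drop 2 i1; n; [::]; [::]; nseq s' One; p; nseq l One; [::]; [::]; r']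
   (3 * size y + 1).
  apply: (@ExecLe _ _ _ (3 * size (nseq (minn l (size y)) One) + 1)).
    apply: exec_eq; first by apply: exec_move_all => //; apply: all_nonblank_nseq.
    rewrite /= /reg /= rev_nseq nseq_cat; congr [:: _; _; _; _; _; _; _; nseq _ _; _; _; _]; lia.
  by rewrite size_nseq; lia.
apply: ExecLe.
  apply: exec_eq; first exact: ExecSeq e1 (ExecSeq e2 (ExecSeq e3 (ExecSeq e4 e5))).
  rewrite /o' /r' /s'; case: leqP => // _.
  by case: (s).
by lia.
Qed.

(** Every round consumes a symbol, so the length of the unread input is enough fuel for [select]. *)
Lemma size_next i : i != [::] -> size (drop 2 (behead (unfield i))) < size i.
Proof.
move=> i0; rewrite size_drop size_behead.
have := congr1 size (field_cat i); rewrite size_cat.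
by case: i i0 => //= a i _; lia.
Qed.

Lemma selectS l m i out s r (y := field i) (i1 := behead (unfield i)) : i != [::] ->
  select l m.+1 i out s r =
  if l <= size y then select l m (drop 2 i1) out s (if r is [::] then y else r)
  else if s is s'.+1 then
    select l m (drop 2 i1) (out ++ y ++ Sep :: take 1 i1 ++ [:: Sep]) s' r
  else select l m (drop 2 i1) out s r.
Proof. by rewrite /y /i1; case: i {y i1}. Qed.

(** How many samples remain wanted depends on the input; a bound is enough, because stack 5 is
    cleared afterwards. *)
Lemma exec_loop l m i out n s p r :
  input_word i -> all nonblank r -> size i <= m ->
  exists2 s', s' <= s &
  exec (While 1 nonblank body_cmd)
    [:: rev out; i; n; [::]; [::]; nseq s One; p; nseq l One; [::]; [::]; r]
    [:: rev (select l m i out s r).1; [::]; n; [::]; [::]; nseq s' One; p; nseq l One;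
        [::]; [::]; (select l m i out s r).2] (m * (13 * m + 27) + 1).
Proof.
elim: m i out s r => [|m IH] i out s r hi hr.
  by rewrite leqn0 => /eqP/size0nil->; exists s => //; apply: ExecWhileF.
have [-> _|i0 him] := eqVneq i [::].
  by exists s => //; apply: ExecLe; [apply: ExecWhileF | lia].
have hb := exec_body l out n s p hi hr i0; rewrite /= in hb.
have pi : nonblank (top [:: rev out; i; n; [::]; [::]; nseq s One; p; nseq l One; [::]; [::]; r] 1).
  by case: i hi i0 {hb him} => //= a i /andP[/orP[/orP[]|] /eqP->].
have sz : size (drop 2 (behead (unfield i))) <= m.
  by rewrite -ltnS; apply: leq_trans (size_next i0) him.
have hi2 : input_word (drop 2 (behead (unfield i))).
  by apply/input_drop/input_behead/input_drop.
have hy : all nonblank (field i) by apply/bits_nonblank/field_bits.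
have cost : (13 * size i + 25) + (m * (13 * m + 27) + 1) + 2 <= m.+1 * (13 * m.+1 + 27) + 1.
  have : 13 * size i <= 13 * m.+1 by rewrite leq_mul2l.
  by lia.
have hr' : all nonblank (if r is [::] then field i else r) by case: (r) hr.
rewrite selectS //; move: hb; case: ifP => hl hb.
- have [s' hs' h] := IH (drop 2 (behead (unfield i))) out s _ hi2 hr' sz.
  by exists s' => //; apply: ExecLe cost; apply: ExecWhileT pi hb h.
case: s hb pi => [|s] hb pi.
  have [s' hs' h] := IH (drop 2 (behead (unfield i))) out 0 _ hi2 hr sz.
  by exists s' => //; apply: ExecLe cost; apply: ExecWhileT pi hb h.
have [s' hs' h] := IH (drop 2 (behead (unfield i)))
  (out ++ field i ++ Sep :: take 1 (behead (unfield i)) ++ [:: Sep]) s _ hi2 hr sz.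
by exists s'; [apply: leqW | apply: ExecLe cost; apply: ExecWhileT pi hb h].
Qed.

Lemma select_input l m i out s r : input_word i -> input_word out -> input_word r ->
  input_word (select l m i out s r).1 /\ input_word (select l m i out s r).2.
Proof.
elim: m i out s r => [|m IH] i out s r hi ho hr; first by split.
rewrite /=; case E : i => [|a i']; first by split.
rewrite -{a i'}E.
have hi1 : input_word (behead (unfield i)) by apply/input_behead/input_drop.
have hi2 := input_drop 2 hi1; have hy := bits_input (field_bits i).
case: ifP => _; first by apply: IH => //; case: (r) hr.
case: s => [|s]; apply: IH => //.
by rewrite !input_cat ho hy /= input_cat input_take.
Qed.

Lemma select_size l m i out s r M : size i <= M -> size r <= M ->
  size (select l m i out s r).2 <= M.
Proof.
elim: m i out s r => [|m IH] i out s r hi hr //.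
have [->//|i0] := eqVneq i [::].
have h := leq_trans (ltnW (size_next i0)) hi.
have hf : size (field i) <= M.
  by apply: leq_trans hi; rewrite -[X in _ <= size X](field_cat i) size_cat leq_addr.
rewrite selectS //; case: ifP => _; first by apply: IH => //; case: (r) hr.
by case: s => [|s]; apply: IH.
Qed.

Definition select_cmd ls ps ss :=
  Seq (move_all 0 1) (Seq count_move (Seq (pop 1) (Seq (push 0 Sep)
  (Seq (Seq (horner ls) (move_all 5 7)) (Seq (Seq (horner ps) (move_all 5 6))
  (Seq (horner ss) (Seq (While 1 nonblank body_cmd) (Seq (pop 10)
  (Seq (While 6 nonblank (Seq (pop 6) (mov 10 0)))
  (Seq (clear 2) (Seq (clear 5) (Seq (clear 7) (clear 10))))))))))))).

(** The first bit of a random string is the constant left by the marker 4, so [behead] removes it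
    before the coins are taken. *)
Definition select_fun ls ps ss w :=
  let x := field w in let i := behead (unfield w) in let n := size x in
  let e := select (poly_eval ls n) (size w) i (x ++ [:: Sep]) (poly_eval ss n) [::] in
  e.1 ++ take (poly_eval ps n) (behead e.2).

Lemma exec_select ls ps ss w (n := size (field w)) : input_word w ->
  exec (select_cmd ls ps ss) (word_store 11 w) (word_store 11 (select_fun ls ps ss w))
    (size w * (13 * size w + 27) + 20 * size w + 40 + horner_cost ls n + horner_cost ps n
     + horner_cost ss n + 10 * poly_eval ls n + 10 * poly_eval ps n + 10 * poly_eval ss n).
Proof.
move=> hw; set x := field w; set i := behead (unfield w).
set l := poly_eval ls n; set p := poly_eval ps n; set s := poly_eval ss n.
have hx : all is_bit x by apply: field_bits.
have hu : input_word (unfield w) by apply: input_drop.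
have hi : input_word i by apply: input_behead.
have sw : size x + size (unfield w) = size w by rewrite -size_cat field_cat.
have si : size i <= size w by rewrite size_behead; lia.
have e1 : exec (move_all 0 1) (word_store 11 w)
    ([::] :: w :: nseq 9 [::]) (3 * size w + 1).
  apply: exec_eq; first by rewrite -(size_rev w); apply: exec_move_all => //; rewrite all_rev input_nonblank.
  by rewrite /= /reg /= revK cats0.
have e2 : exec count_move ([::] :: w :: nseq 9 [::])
    [:: rev x, unfield w, nseq n One & nseq 8 [::]] (4 * n + 1).
  have := @exec_count_move x (unfield w) [::] 0 (nseq 8 [::]) hx (unfield_head w).
  by rewrite field_cat cats0 addn0.
have e3 : exec (pop 1) [:: rev x, unfield w, nseq n One & nseq 8 [::]]
   [:: rev x, i, nseq n One & nseq 8 [::]] 1 by apply: ExecOp.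
have e4 : exec (push 0 Sep) [:: rev x, i, nseq n One & nseq 8 [::]]
   [:: rev (x ++ [:: Sep]), i, nseq n One & nseq 8 [::]] 1.
  by apply: exec_eq; first exact: ExecOp; rewrite rev_cat.
set o := rev (x ++ [:: Sep]) in e4 *.
have e5 : exec (Seq (horner ls) (move_all 5 7)) [:: o, i, nseq n One & nseq 8 [::]]
   [:: o; i; nseq n One; [::]; [::]; [::]; [::]; nseq l One; [::]; [::]; [::]]
   (horner_cost ls n + (3 * l + 1)).
  apply: ExecSeq (exec_horner _ _ _ _ _) _.
  rewrite -{2}(size_nseq l One); apply: exec_eq.
    by apply: exec_move_all => //; apply: all_nonblank_nseq.
  by rewrite /= /reg /= rev_nseq cats0.
have e6 : exec (Seq (horner ps) (move_all 5 6))
   [:: o; i; nseq n One; [::]; [::]; [::]; [::]; nseq l One; [::]; [::]; [::]]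
   [:: o; i; nseq n One; [::]; [::]; [::]; nseq p One; nseq l One; [::]; [::]; [::]]
   (horner_cost ps n + (3 * p + 1)).
  apply: ExecSeq (exec_horner _ _ _ _ _) _.
  rewrite -{2}(size_nseq p One); apply: exec_eq.
    by apply: exec_move_all => //; apply: all_nonblank_nseq.
  by rewrite /= /reg /= rev_nseq cats0.
have e7 := exec_horner ss n o i
  [:: nseq p One; nseq l One; [::]; [::]; [::]].
have [s' hs' e8] := @exec_loop l (size w) i (x ++ [:: Sep]) (nseq n One) s (nseq p One) [::]
  hi isT si.
have := @select_size l (size w) i (x ++ [:: Sep]) s [::] (size w) si isT.
have := @select_input l (size w) i (x ++ [:: Sep]) s [::] hi.
rewrite /select_fun -/x -/i -/n -/l -/p -/s.
set e := select _ _ _ _ _ _ in e8 *.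
rewrite input_cat (bits_input hx) => /(_ isT isT) [ho hr] sr.
have hr' := input_behead hr.
set st := [:: rev (e.1 ++ take p (behead e.2)); [::]; nseq n One; [::]; [::]; nseq s' One;
   [::]; nseq l One; [::]; [::]; drop p (behead e.2)].
have e9 : exec (pop 10)
   [:: rev e.1; [::]; nseq n One; [::]; [::]; nseq s' One; nseq p One; nseq l One; [::]; [::]; e.2]
   [:: rev e.1; [::]; nseq n One; [::]; [::]; nseq s' One; nseq p One; nseq l One; [::]; [::];
    behead e.2] 1 by apply: ExecOp.
have e10 : exec (While 6 nonblank (Seq (pop 6) (mov 10 0)))
   [:: rev e.1; [::]; nseq n One; [::]; [::]; nseq s' One; nseq p One; nseq l One; [::]; [::];
    behead e.2] st (4 * p + 1).
  apply: exec_eq.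
    exact: (@exec_move_count 6 10 0 p [:: rev e.1; [::]; nseq n One; [::]; [::]; nseq s' One;
      nseq p One; nseq l One; [::]; [::]; behead e.2] isT isT isT isT isT isT erefl (input_nonblank hr')).
  by rewrite /= /reg /= /st rev_cat.
have e11 : exec (Seq (clear 2) (Seq (clear 5) (Seq (clear 7) (clear 10)))) st
    (word_store 11 (e.1 ++ take p (behead e.2)))
    (3 * n + 1 + (3 * s' + 1 + (3 * l + 1 + (3 * size (drop p (behead e.2)) + 1)))).
  apply: ExecSeq.
    by rewrite -{2}(size_nseq n One); apply: exec_clear => //; apply: all_nonblank_nseq.
  apply: ExecSeq.
    by rewrite -{2}(size_nseq s' One); apply: exec_clear => //; apply: all_nonblank_nseq.
  apply: ExecSeq.
    by rewrite -{2}(size_nseq l One); apply: exec_clear => //; apply: all_nonblank_nseq.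
  by apply: exec_eq; first by apply: exec_clear => //; apply/input_nonblank/input_drop.
apply: ExecLe.
  exact: ExecSeq e1 (ExecSeq e2 (ExecSeq e3 (ExecSeq e4 (ExecSeq e5 (ExecSeq e6 (ExecSeq e7
    (ExecSeq e8 (ExecSeq e9 (ExecSeq e10 e11))))))))).
rewrite size_drop size_behead -/l -/p -/s.
have : n <= size w by rewrite -sw leq_addr.
by lia.
Qed.

Lemma wf_select ls ps ss : wf_cmd 11 (select_cmd ls ps ss).
Proof.
have h cs := @wf_horner 11 cs isT.
by do !split.
Qed.

Lemma select_fun_input ls ps ss w : input_word w -> input_word (select_fun ls ps ss w).
Proof.
move=> hw; rewrite /select_fun.
have hi : input_word (behead (unfield w)) by apply/input_behead/input_drop.
have ho : input_word (field w ++ [:: Sep]) by rewrite input_cat (bits_input (field_bits w)).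
have [h1 h2] := select_input (poly_eval ls (size (field w))) (size w)
  (poly_eval ss (size (field w))) hi ho (erefl : input_word [::]).
by rewrite input_cat h1 input_take // input_behead.
Qed.

(** * The failure probability *)

Section Probability.
Local Open Scope ring_scope.

(** Averages as monotone, linear, normalised functionals. They can be iterated over sequences
    without a finite sample space on the type of all bit strings; counting enters only at the
    end. *)
Record expectation (T : Type) (E : (T -> rat) -> rat) := Expectation {
  exp_le : forall f g, (forall x, f x <= g x) -> E f <= E g;
  exp_lin : forall a b f g, E (fun x => a * f x + b * g x) = a * E f + b * E g;
  exp_const : forall c, E (fun=> c) = c }.

Lemma exp_eq T E f g : @expectation T E -> (forall x, f x = g x) -> E f = E g.
Proof. by move=> h e; apply/eqP; rewrite eq_le !(exp_le h) // => x; rewrite e. Qed.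

Lemma exp_addc T E f c : @expectation T E -> E (fun x => f x + c) = E f + c.
Proof.
move=> h; have := exp_lin h 1 1 f (fun=> c); rewrite (exp_const h) !mul1r => <-.
by apply: exp_eq => // x; rewrite !mul1r.
Qed.

Definition coin (f : bool -> rat) : rat := (f true + f false) / 2%:R.

Lemma coin_exp : expectation coin.
Proof.
split=> [f g h|a b f g|c]; rewrite /coin; [|by ring|by lra].
by have := h true; have := h false; lra.
Qed.

Fixpoint iter_exp T (E : (T -> rat) -> rat) n (f : seq T -> rat) : rat :=
  if n is n'.+1 then E (fun x => iter_exp E n' (fun l => f (x :: l))) else f [::].

Lemma iter_expP T E n : @expectation T E -> expectation (iter_exp E n).
Proof.
move=> h; split; elim: n => [|n IH] //=.
- by move=> f g hf; apply: (exp_le h) => x; apply: IH => l; apply: hf.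
- by move=> a b f g; rewrite -(exp_lin h); apply: exp_eq => // x; apply: IH.
- by move=> c; rewrite -[RHS](exp_const h); apply: exp_eq => // x; apply: IH.
Qed.

Lemma iter_exp_eq T E n f g : @expectation T E ->
  (forall l, size l = n -> f l = g l) -> iter_exp E n f = iter_exp E n g.
Proof.
move=> h; elim: n f g => [|n IH] f g e /=; first exact: e.
by apply: exp_eq => // x; apply: IH => l hl; apply: e; rewrite /= hl.
Qed.

Lemma iter_exp_cat T E a b f : @expectation T E ->
  iter_exp E (a + b) f = iter_exp E a (fun u => iter_exp E b (fun v => f (u ++ v))).
Proof. by move=> h; elim: a f => [|a IH] f //=; apply: exp_eq. Qed.

Definition bits n := iter_exp coin n.

Lemma bits_exp n : expectation (bits n).
Proof. exact: iter_expP coin_exp. Qed.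

(** Interchange of two averages; linearity suffices, since [bits] is an iterated mean of two values.
    The counting form averages the coins of [M] innermost, [ideal] outermost. *)
Lemma bits_swap T (E : (T -> rat) -> rat) n f : expectation E ->
  bits n (fun v => E (fun x => f x v)) = E (fun x => bits n (f x)).
Proof.
move=> h; elim: n f => [|n IH] f //; rewrite /bits /= /coin.
have := IH (fun x l => f x (true :: l)); have := IH (fun x l => f x (false :: l)).
rewrite /bits => -> ->; rewrite mulrDl ![_ / _]mulrC -(exp_lin h).
by apply: exp_eq => // x; ring.
Qed.

(** The selection read off the coins [t] of each sample instead of its output: bit [q] is the extra
    coin, the bits before it drive the original sampler, the [p] bits after it serve as coins of
    [M]. *)
Fixpoint proc q p (ts : seq (seq bool)) acc s (r : option (seq bool)) :=
  if ts is t :: ts' then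
    if nth false t q then
      proc q p ts' acc s (if r is None then Some (take p (drop q.+1 t)) else r)
    else if s is s'.+1 then proc q p ts' (rcons acc (take q t)) s' r
    else proc q p ts' acc s r
  else (acc, r).

(** The extra coin is independent of the bits on either side, and the [e] padding bits average
    out. *)
Lemma bits_step q p e (h0 h1 : seq bool -> rat) :
  bits (q + (1 + (p + e))) (fun t =>
    if nth false t q then h1 (take p (drop q.+1 t)) else h0 (take q t)) =
  (bits p h1 + bits q h0) / 2%:R.
Proof.
have ex := coin_exp; rewrite /bits iter_exp_cat //.
transitivity (bits q (fun u => (1 / 2%:R) * bits p h1 + (1 / 2%:R) * h0 u)).
  apply: iter_exp_eq => // u hu; rewrite /= /coin.
  have -> : iter_exp coin (p + e) (fun l => if nth false (u ++ true :: l) q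
      then h1 (take p (drop q.+1 (u ++ true :: l))) else h0 (take q (u ++ true :: l))) = bits p h1.
    rewrite iter_exp_cat //; apply: iter_exp_eq => // v hv.
    rewrite -[RHS](exp_const (iter_expP e ex)); apply: iter_exp_eq => // l _.
    rewrite nth_cat -hu ltnn subnn /=; congr h1.
    by rewrite -cat_rcons drop_size_cat ?size_rcons // -hv take_size_cat.
  have -> : iter_exp coin (p + e) (fun l => if nth false (u ++ false :: l) q
      then h1 (take p (drop q.+1 (u ++ false :: l))) else h0 (take q (u ++ false :: l))) = h0 u.
    rewrite -[RHS](exp_const (iter_expP (p + e) ex)); apply: iter_exp_eq => // l _.
    by rewrite nth_cat -hu ltnn subnn /= take_size_cat.
  by lra.
rewrite (exp_lin (bits_exp q)) (exp_const (bits_exp q)) -/(bits p h1) -/(bits q h0); lra.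
Qed.

Section Process.
Variables (q p e : nat) (A : seq (seq bool) -> seq bool -> rat).
Hypothesis A01 : forall g v, 0 <= A g v <= 1.

Definition ideal_with s acc v := iter_exp (bits q) s (fun g => A (acc ++ g) v).

(** The expected value of [A] if whatever is still missing were drawn afresh. Its average over the
    next sample, of either kind, is itself: a martingale. *)
Definition ideal s acc r :=
  if r is Some v then ideal_with s acc v else bits p (ideal_with s acc).

(* Bounds the probability that [n] samples do not contain [s] samples of the
   first kind and, if [r] is [None], one of the second: averaged over the two
   outcomes of a sample it drops by a factor of at least 3/4, as long as
   something is missing. *)
Definition potential n s (r : option (seq bool)) : rat :=
  (3%:R / 4%:R) ^+ n * (2%:R ^+ s * (if r is Some _ then 1 else 2%:R)).

Lemma exp_ge0 T (E : (T -> rat) -> rat) f : expectation E -> (forall x, 0 <= f x) -> 0 <= E f.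
Proof. by move=> h hf; rewrite -(exp_const h 0); apply: exp_le. Qed.

Lemma ideal_ge0 s acc r : 0 <= ideal s acc r.
Proof.
have hw v : 0 <= ideal_with s acc v.
  apply: exp_ge0; first exact: iter_expP (bits_exp q).
  by move=> g; have /andP[] := A01 (acc ++ g) v.
case: r => [v|]; first exact: hw.
exact: (exp_ge0 (bits_exp p) hw).
Qed.

Lemma ideal_step s acc r :
  ideal s.+1 acc r = bits q (fun u => ideal s (rcons acc u) r).
Proof.
have hw v : ideal_with s.+1 acc v = bits q (fun u => ideal_with s (rcons acc u) v).
  apply: exp_eq (bits_exp q) _ => u; apply: exp_eq; first exact: iter_expP (bits_exp q).
  by move=> g; rewrite cat_rcons.
case: r => [v|] //=; rewrite -(bits_swap p _ (bits_exp q)).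
by apply: exp_eq (bits_exp p) _ => v; rewrite hw.
Qed.

Definition final (x : seq (seq bool) * option (seq bool)) := A x.1 (odflt [::] x.2).

Definition coin_count := (q + (1 + (p + e)))%N.

Lemma potentialS n s r : potential n.+1 s r = 3%:R / 4%:R * potential n s r.
Proof. by rewrite /potential exprS -mulrA. Qed.

Lemma potential_sS n s r : potential n s.+1 r = 2%:R * potential n s r.
Proof. by rewrite /potential exprS -mulrA mulrCA. Qed.

Lemma potential_None n s : potential n s None = 2%:R * potential n s (Some [::]).
Proof. by rewrite /potential mulr1 mulrA mulrC. Qed.

Lemma potential_Some n s v : potential n s (Some v) = potential n s (Some [::]).
Proof. by []. Qed.

Lemma potential_ge0 n s r : 0 <= potential n s r.
Proof.
rewrite /potential; have h1 : 0 <= (3%:R / 4%:R : rat) ^+ n by apply: exprn_ge0; lra.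
have h2 : 0 <= (2%:R : rat) ^+ s by apply: exprn_ge0; lra.
by apply: mulr_ge0 => //; apply: mulr_ge0 => //; case: r.
Qed.

Lemma proc_done ts acc v : proc q p ts acc 0 (Some v) = (acc, Some v).
Proof. by elim: ts => //= t ts ->; case: ifP. Qed.

Lemma process_done n acc v :
  iter_exp (bits coin_count) n (fun ts => final (proc q p ts acc 0 (Some v))) <=
  ideal 0 acc (Some v) + potential n 0 (Some v).
Proof.
rewrite (iter_exp_eq (g := fun=> A acc v) (bits_exp _)) => [|ts _].
  rewrite (exp_const (iter_expP _ (bits_exp _))) /= /ideal_with /= cats0.
  by rewrite lerDl potential_ge0.
by rewrite proc_done.
Qed.

(** Induction on [n]; the ideal value is preserved on average, so only the potential matters. If
    both kinds are missing, either outcome halves it. If one kind is missing, that outcome halves it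
    and the other leaves it unchanged, which averages to 3/4. If nothing is missing, [A] is already
    determined. *)
Lemma process_le n s acc r :
  iter_exp (bits coin_count) n (fun ts => final (proc q p ts acc s r)) <=
  ideal s acc r + potential n s r.
Proof.
have hq := bits_exp q; have hp := bits_exp p.
elim: n s acc r => [|n IH] s acc r.
  (* With no samples left, either the selection is complete and the value is the ideal one, or
     something is missing and the potential is at least 1, hence at least [A]. *)
  have h0 := ideal_ge0 s acc r; have h1 := potential_ge0 0 s r.
  have /andP[_ hA1] := A01 acc (odflt [::] r).
  case: s h0 h1 => [|s] h0 h1; first case: r h0 h1 hA1 => [v|] h0 h1 hA1.
  - by rewrite /= /ideal /= /ideal_with /= cats0 /final /= lerDl.
  - rewrite /=; apply: le_trans hA1 _; rewrite -[X in X <= _]add0r; apply: lerD => //.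
  - rewrite /=; apply: le_trans hA1 _; rewrite -[X in X <= _]add0r; apply: lerD => //.
    rewrite /potential expr0 mul1r.
    have h2 : 1 <= (2%:R : rat) ^+ s.+1 by apply: exprn_ege1; lra.
    case: (r) => [v|]; first by rewrite mulr1.
    by apply: (le_trans h2); apply: ler_peMr => //; apply: le_trans h2.
have [[-> [v ->]]|nd] : (s = 0%N /\ exists v, r = Some v) \/ (s != 0%N) || (r == None).
- by case: s r => [|s] [v|]; [left; split => //; exists v | right..].
- exact: process_done.
rewrite [iter_exp _ _ _]/=.
pose r1 v := if r is None then Some v else r.
pose h1 v := iter_exp (bits coin_count) n (fun ts => final (proc q p ts acc s (r1 v))).
pose h0 u := iter_exp (bits coin_count) n (fun ts => final
  (if s is s'.+1 then proc q p ts (rcons acc u) s' r else proc q p ts acc s r)).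
have -> : bits coin_count (fun t => iter_exp (bits coin_count) n
    (fun l => final (proc q p (t :: l) acc s r))) = (bits p h1 + bits q h0) / 2%:R.
  rewrite -(bits_step q p e); apply: exp_eq (bits_exp _) _ => t.
  rewrite /= /h1 /h0 /r1; case: ifP => _; first by case: (r).
  by case: (s).
have b1 : bits p h1 <= ideal s acc r + potential n s (Some [::]).
  case: r {nd h0} @r1 @h1 => [v|] r1 h1.
    apply: le_trans (exp_le hp (g := fun=> ideal s acc (Some v) + potential n s (Some v)) _) _.
      by move=> u; apply: IH.
    by rewrite (exp_const hp).
  apply: le_trans (exp_le hp (g := fun v => ideal_with s acc v + potential n s (Some [::])) _) _.
    by move=> v; apply: IH.
  by rewrite exp_addc.
case: s @h0 @h1 b1 nd => [|s] h0 h1 b1 nd.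
  have b0 : bits q h0 <= ideal 0 acc r + potential n 0 r.
    by rewrite -[X in _ <= X](exp_const hq); apply: exp_le => // u; apply: IH.
  move: nd b0 b1; rewrite potentialS => /eqP->.
  by rewrite potential_None; lra.
have b0 : bits q h0 <= ideal s.+1 acc r + potential n s r.
  rewrite ideal_step -exp_addc //; apply: exp_le => // u; exact: IH.
move: b0 b1 (potential_ge0 n s (Some [::])); rewrite potentialS.
case: (r) => [v|]; first by rewrite potential_Some !potential_sS; lra.
by rewrite !potential_None !potential_sS; lra.
Qed.

End Process.

(** * From expectations to counting *)

Lemma sum_ffun (T : finType) X (h : T -> X) E (K : rat) s f :
  expectation E -> (forall g, \sum_(t : T) g (h t) = K * E g) ->
  \sum_(w : {ffun 'I_s -> T}) f [seq h (w i) | i <- enum 'I_s] = K ^+ s * iter_exp E s f.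
Proof.
move=> hE hK; elim: s f => [|s IH] f.
  rewrite expr0 mul1r (eq_bigr (fun=> f [::])) => [|w _]; last by rewrite enum_ord0.
  by rewrite sumr_const card_ffun card_ord expn0.
(* Splitting off the value at 0 makes functions on [s.+1] points into pairs, and the sum into nested
   sums that mirror [iter_exp]. *)
pose j (p : T * {ffun 'I_s -> T}) : {ffun 'I_s.+1 -> T} :=
  [ffun i => if unlift ord0 i is Some i' then p.2 i' else p.1].
pose j' (w : {ffun 'I_s.+1 -> T}) : T * {ffun 'I_s -> T} :=
  (w ord0, [ffun i => w (lift ord0 i)]).
have jj : {on predT, bijective j}.
  apply: onW_bij; exists j' => [[a b]|w]; rewrite /j /j'.
    congr pair; first by rewrite ffunE unlift_none.
    by apply/ffunP => i; rewrite !ffunE liftK.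
  by apply/ffunP => i; rewrite !ffunE; case: unliftP => [i' ->|->]; rewrite ?ffunE.
rewrite (reindex j) //= -(pair_big predT predT (fun a b =>
   f [seq h (j (a, b) i) | i <- enum 'I_s.+1])) /=.
transitivity (\sum_(a : T) K ^+ s * iter_exp E s (fun l => f (h a :: l))).
  apply: eq_bigr => a _; rewrite -IH; apply: eq_bigr => b _.
  rewrite enum_ordSl /= -map_comp; congr (f (h _ :: _)); first by rewrite ffunE unlift_none.
  by apply: eq_map => i; rewrite /= ffunE liftK.
by rewrite -mulr_sumr (hK (fun x => iter_exp E s (fun l => f (x :: l)))) exprSr mulrA.
Qed.

(** A bit string is a family of independent fair coins, so this is [sum_ffun] for [coin], with
    weight 2 per coordinate. *)
Lemma sum_tuple n f : \sum_(t : n.-tuple bool) f (val t) = 2%:R ^+ n * bits n f.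
Proof.
rewrite -(sum_ffun (h := id) n f coin_exp) => [|g]; last by rewrite big_bool /coin mulrC divfK.
rewrite (reindex (fun w : {ffun 'I_n -> bool} => [tuple w i | i < n])) //=.
apply: onW_bij; exists (fun t : n.-tuple bool => [ffun i => tnth t i]) => [w|t].
  by apply/ffunP => i; rewrite ffunE tnth_mktuple.
by apply: eq_from_tnth => i; rewrite tnth_mktuple ffunE.
Qed.

Definition samples q s (w : {ffun 'I_s -> q.-tuple bool}) : seq (seq bool) :=
  [seq val (w i) | i <- enum 'I_s].

Lemma card_samples q s p (P : seq (seq bool) -> seq bool -> bool) :
  (#|[set w : {ffun 'I_s -> q.-tuple bool} * p.-tuple bool |
      P (samples w.1) (val w.2)]|%:R : rat) =
  2%:R ^+ (q * s + p) * iter_exp (bits q) s (fun g => bits p (fun v => (P g v)%:R)).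
Proof.
rewrite -sum1dep_card natr_sum big_mkcond /=.
rewrite (eq_bigr (fun w => (P (samples w.1) (val w.2))%:R)) => [|w _]; last by case: (P _ _).
rewrite -(pair_big predT predT (fun a b => (P (samples a) (val b))%:R : rat)) /=.
rewrite (eq_bigr (fun a => 2%:R ^+ p * bits p (fun v => (P (samples a) v)%:R))) => [|a _];
  last exact: (sum_tuple p (fun v => (P (samples a) v)%:R)).
rewrite -mulr_sumr (sum_ffun (h := val) s (fun g => bits p (fun v => (P g v)%:R)) (bits_exp q) (@sum_tuple q)).
by rewrite mulrA -exprM -exprD addnC.
Qed.

Lemma card_all_samples q s p :
  (#|[set: {ffun 'I_s -> q.-tuple bool} * p.-tuple bool]|%:R : rat) = 2%:R ^+ (q * s + p).
Proof.
have := @card_samples q s p (fun _ _ => true); rewrite (_ : [set w | _] = setT); last first.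
  by apply/setP => w; rewrite !inE.
move=> ->; rewrite (exp_eq (g := fun=> 1) (iter_expP s (bits_exp q))) => [|g].
  by rewrite (exp_const (iter_expP s (bits_exp q))) mulr1.
exact: exp_const (bits_exp p) _.
Qed.

(** Since [(3/4)^3 = 27/64 < 1/2], three samples gain a factor 2. The summand 4 in [M] provides
    1/16, which beats the remaining constant 6: a 3 from the error bound and a 2 from the missing
    random string. *)
Lemma potential_small m n s (M := (s + m + 4)%N) :
  (3 * M <= n)%N -> potential n s None * 3%:R * 2%:R ^+ m < 1.
Proof.
move=> hn; pose x : rat := 3%:R / 4%:R.
have h1 : x ^+ n <= (1 / 2%:R) ^+ M.
  apply: (@le_trans _ _ (x ^+ (3 * M))).
    by apply: ler_wiXn2l => //; rewrite /x; lra.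
  by rewrite exprM; apply: lerXn2r; rewrite ?nnegrE /x; lra.
have hM : ((1 / 2%:R) ^+ M * 2%:R ^+ (s + m) : rat) = 1 / 16%:R.
  rewrite /M exprD mulrAC -exprMn (_ : 1 / 2%:R * 2%:R = 1); last by lra.
  by rewrite expr1n mul1r; lra.
have hp : 0 < (2%:R ^+ (s + m) : rat) by apply: exprn_gt0.
have h2 : x ^+ n * 2%:R ^+ (s + m) <= 1 / 16%:R by rewrite -hM ler_pM2r.
rewrite /potential -/x.
have -> : x ^+ n * (2%:R ^+ s * 2%:R) * 3%:R * 2%:R ^+ m = 6%:R * (x ^+ n * 2%:R ^+ (s + m)).
  by rewrite exprD; ring.
lra.
Qed.

Lemma process_error q p e s n (A : seq (seq bool) -> seq bool -> bool)
    (qq := (q + (1 + (p + e)))%N) :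
  (3 * (s + (q * s + p) + 4) <= n)%N ->
  (3 * #|[set w : {ffun 'I_s -> q.-tuple bool} * p.-tuple bool |
        A (samples w.1) (val w.2)]|
   < #|[set: {ffun 'I_s -> q.-tuple bool} * p.-tuple bool]|)%N ->
  (3 * #|[set w : {ffun 'I_n -> qq.-tuple bool} * 0.-tuple bool |
        let x := proc q p (samples w.1) [::] s None in A x.1 (odflt [::] x.2)]|
   < #|[set: {ffun 'I_n -> qq.-tuple bool} * 0.-tuple bool]|)%N.
Proof.
(* The strict inequality of integers is kept as [_.+1 <= _]: this unit is the gap into which the
   potential has to fit. *)
move=> hn; rewrite -(ler_nat rat) => h; rewrite -(ltr_nat rat); move: h.
rewrite -addn1 natrD !natrM card_all_samples card_samples card_all_samples.
rewrite (card_samples qq n 0 (fun g _ =>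
  let x := proc q p g [::] s None in A x.1 (odflt [::] x.2))).
pose B g v : rat := (A g v)%:R.
have B01 g v : 0 <= B g v <= 1 by rewrite /B; case: (A g v).
have := @process_le q p e B B01 n s [::] None.
have := potential_small hn.
rewrite /ideal /ideal_with (bits_swap p _ (iter_expP s (bits_exp q))) /=.
set a := iter_exp (bits q) s _; set a' := iter_exp _ n _;
set pot := potential _ _ _; set K := 2%:R ^+ (q * s + p); set K' := 2%:R ^+ _.
have K0 : 0 < K by apply: exprn_gt0.
have K0' : 0 < K' by apply: exprn_gt0.
move=> h1 h2 h3.
have h4 : 3%:R * a' < 1.
  rewrite -(ltr_pM2r K0) mul1r.
  have : a' * K <= (a + pot) * K by rewrite ler_pM2r.
  by move: h1 h3; nra.
by rewrite mulrCA -[X in _ < X]mulr1 ltr_pM2l.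
Qed.
End Probability.

(** * Encodings *)

Lemma enc_bits_bit r : all is_bit (enc_bits r).
Proof. by elim: r => //= -[] r ->. Qed.

Lemma enc_bitsK r : bits_prefix (enc_bits r) = r.
Proof. by rewrite /bits_prefix; elim: r => //= -[] r /= ->. Qed.

Lemma sampler_fun_enc qs n r (q := poly_eval qs n) :
  sampler_fun qs (nseq n One ++ Sep :: enc_bits r) =
  if nth false r q then 4 :: enc_bits (drop q.+1 r)
  else nseq n One ++ Sep :: enc_bits (take q r).
Proof.
have h1 : all is_bit (nseq n One) by rewrite all_nseq orbT.
have hb : behead (drop q (enc_bits r)) = enc_bits (drop q.+1 r).
  by rewrite /enc_bits map_drop -drop1 drop_drop add1n.
have hh : (head 0 (drop q (enc_bits r)) == One) = nth false r q.
  rewrite /enc_bits -map_drop -[in RHS](addn0 q) -nth_drop nth0.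
  by case: (drop q r) => [|[] l].
by rewrite /sampler_fun field_sep // unfield_sep // size_nseq -/q /= hh hb /enc_bits map_take.
Qed.

Definition enc_samples (T : seq (seq bool * bool)) :=
  flatten [seq enc_bits p.1 ++ [:: Sep; enc_bit p.2; Sep] | p <- T].

Lemma enc_samples_cons y b T :
  enc_samples ((y, b) :: T) = enc_bits y ++ Sep :: enc_bit b :: Sep :: enc_samples T.
Proof. by rewrite /enc_samples /= -catA. Qed.

Lemma enc_samples_rcons y b T :
  enc_samples (rcons T (y, b)) = enc_samples T ++ enc_bits y ++ [:: Sep; enc_bit b; Sep].
Proof. by rewrite /enc_samples map_rcons flatten_rcons. Qed.

Lemma enc_samples_input T : input_word (enc_samples T).
Proof.
elim: T => [|[y b] T IH] //; rewrite enc_samples_cons input_cat (bits_input (enc_bits_bit y)) /=.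
by rewrite IH; case: b.
Qed.

Lemma enc_input_input x T r : input_word (enc_input x T r).
Proof.
rewrite /enc_input -/(enc_samples T) -cat1s !input_cat enc_samples_input.
by rewrite (bits_input (enc_bits_bit x)) (bits_input (enc_bits_bit r)).
Qed.

Lemma enc_samples_size T : size T <= size (enc_samples T).
Proof. by elim: T => [|[y b] T IH] //; rewrite enc_samples_cons size_cat /=; lia. Qed.

(** The loop of [select] on decoded samples, the link between words on the tape and [proc]. *)
Fixpoint pick_samples l (T out : seq (seq bool * bool)) s (r : seq bool) :=
  if T is (y, b) :: T' then
    if l <= size y then pick_samples l T' out s (if r is [::] then y else r)
    else if s is s'.+1 then pick_samples l T' (rcons out (y, b)) s' r
    else pick_samples l T' out s r
  else (out, r).

Lemma select_enc l m T pre out s r : size T <= m ->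
  select l m (enc_samples T) (pre ++ enc_samples out) s (enc_bits r) =
  (pre ++ enc_samples (pick_samples l T out s r).1,
   enc_bits (pick_samples l T out s r).2).
Proof.
elim: T m out s r => [|[y b] T IH] [|m] out s r // hm.
rewrite selectS; last by rewrite enc_samples_cons; case: (enc_bits y).
rewrite enc_samples_cons field_sep ?enc_bits_bit // unfield_sep ?enc_bits_bit //.
rewrite [behead _]/= [drop 2 _]/= drop0 [take 1 _]/= size_map [pick_samples _ _ _ _ _]/=.
case: leqP => _.
  by rewrite -(IH m) //; case: (r).
case: s => [|s]; first by rewrite -(IH m).
by rewrite -(IH m) // enc_samples_rcons -!catA.
Qed.

Lemma select_fun_enc ls ps ss x T (n := size x) :
  let z := pick_samples (poly_eval ls n) T [::] (poly_eval ss n) [::] in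
  select_fun ls ps ss (enc_input x T [::]) =
  enc_input x z.1 (take (poly_eval ps n) (behead z.2)).
Proof.
rewrite /select_fun /enc_input -!/(enc_samples _) cats0.
rewrite field_sep ?enc_bits_bit // unfield_sep ?enc_bits_bit // [behead (_ :: _)]/= size_map -/n.
have := @select_enc (poly_eval ls n) (size (enc_bits x ++ Sep :: enc_samples T)) T
  (enc_bits x ++ [:: Sep]) [::] (poly_eval ss n) [::].
rewrite cats0 => -> /=; last first.
  by rewrite size_cat /=; apply: leq_trans (enc_samples_size T) _; lia.
set z := pick_samples _ _ _ _ _.
rewrite -!catA /=; congr (_ ++ _ :: _ ++ _).
by rewrite /enc_bits map_take; case: (z.2).
Qed.

Lemma pick_proc l q p (f g : seq bool -> seq bool) (L : language) ts acc s r :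
  (forall t, f t = if nth false t q then true :: drop q.+1 t else g (take q t)) ->
  (forall t, t \in ts -> (l <= size (f t)) = nth false t q) ->
  let z := pick_samples l [seq (f t, L (f t)) | t <- ts] [seq (g u, L (g u)) | u <- acc] s r in
  let z' := proc q p ts acc s (if r is [::] then None else Some (take p (behead r))) in
  z.1 = [seq (g u, L (g u)) | u <- z'.1] /\ take p (behead z.2) = odflt [::] z'.2.
Proof.
move=> hf; elim: ts acc s r => [|t ts IH] acc s r hl; first by case: r.
have {}IH acc s r := IH acc s r (fun t h => hl t (mem_behead (h : t \in behead (_ :: ts)))).
rewrite /= hl ?mem_head //; case: ifP => ht.
  by case: r => [|c r]; [rewrite hf ht|]; apply: IH.
case: s => [|s]; first exact: IH.
by rewrite hf ht -map_rcons; apply: IH.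
Qed.

Lemma size_cright_run M t c : size (cright (run M t c)) <= size (cright c) + t.
Proof.
elim: t c => [|t IH] c /=; first by rewrite addn0.
rewrite /step; case: (lookup M _ _) => [e|] /=; last by rewrite leq_addr.
apply: leq_trans (IH _) _; rewrite do_moveE; case: e.2 => /=; rewrite ?size_behead; lia.
Qed.

(** A step adds at most one cell to the right part of the tape, so the running time bounds the
    output length. This makes some length unreachable for the original sampler. *)
Lemma size_out_bits D tD w :
  size (out_bits (output D tD w)) <= size w + poly_eval tD (size w) + 1.
Proof.
rewrite /out_bits size_map size_take.
rewrite /output; set c := run _ _ _.
apply: (@leq_trans (size (cright c)).+1) => /=; first by case: ltnP => // /ltnW.
rewrite addn1 ltnS; apply: leq_trans (size_cright_run _ _ _) _.
by rewrite leq_add2r; case: (w) => //= *; apply: leqnSn.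
Qed.

(** * The two inclusions *)

Lemma det_samp L : Psamp L -> BPPsamp L.
Proof.
move=> [M [D [tM [tD [qD [pM [sN [_ h]]]]]]]].
by exists M, D, tM, tD, qD, pM, sN.
Qed.

Lemma card_set_compl (T : finType) (P : pred T) :
  #|[set w | P w]| + #|[set w | ~~ P w]| = #|[set: T]|.
Proof.
rewrite cardsT -(cardsC [set w | P w]); congr (_ + #|pred_of_set _|).
by apply/setP => w; rewrite !inE.
Qed.

(** Acceptance above 2/3 is rejection below 1/3; this reduces members of [L] to the bound for
    nonmembers. *)
Lemma majority_compl a b k : a + b = k -> (2 * k < 3 * a) = (3 * b < k).
Proof. lia. Qed.

Theorem theorem9 : forall L : language, BPPsamp L <-> Psamp L.
Proof.
move=> L; split; last exact: det_samp.
move=> [M [D [tM [tD [qD [pM [sN [_ [hM [hD hL]]]]]]]]]].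
pose s := poly_eval sN; pose q := poly_eval qD; pose p := poly_eval pM.
(* The bound of [size_out_bits] for the sampler's input, which consists of [n] ones, a separator and
   [q n] coins. *)
pose B n := (n + (q n + 1)) + poly_eval tD (n + (q n + 1)) + 1.
(* The length of a random string, one marker bit and [p n + B n] coins; it exceeds [B n], hence
   every genuine sample. *)
have [ls hls] : is_poly (fun n => p n + B n + 1) by is_poly.
(* Coins per sample: [q n] for the original sampler, the extra coin, [p n] for [M], and [B n] of
   padding. *)
have [qs hqs] : is_poly (fun n => q n + (1 + (p n + B n))) by is_poly.
(* The number of samples required by [process_error], where [q n * s n + p n] is the total number of
   coins in the given experiment. *)
have [ns hns] : is_poly (fun n => 3 * (s n + (q n * s n + p n) + 4)) by is_poly.
have fw w : size (field w) <= size w.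
  by rewrite -[X in _ <= size X](field_cat w) size_cat leq_addr.
(* The program costs are stated in the length of the first field, the running time in that of the
   whole word; monotonicity of polynomials passes from one to the other. *)
have cost_mono cs w : horner_cost cs (size (field w)) <= horner_cost cs (size w).
  by have [ds h] := is_poly_horner_cost cs; rewrite -!h poly_eval_mono.
pose TD n := 20 * n + 40 + horner_cost qD n + 4 * poly_eval qD n.
pose TM n := n * (13 * n + 27) + 20 * n + 40 + horner_cost ls n + horner_cost pM n
    + horner_cost sN n + 10 * poly_eval ls n + 10 * poly_eval pM n + 10 * poly_eval sN n.
have exD w (hw : input_word w) := exec_sampler qD hw.
have exM w (hw : input_word w) := exec_select ls pM sN hw.
have {}exD w (hw : input_word w) :
    exec (sampler_cmd qD) (word_store 6 w) (word_store 6 (sampler_fun qD w)) (TD (size w)).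
  apply: ExecLe (exD w hw) _; rewrite /TD.
  by apply: leq_add; rewrite ?leq_add2l ?leq_mul2l ?poly_eval_mono.
have {}exM w (hw : input_word w) :
    exec (select_cmd ls pM sN) (word_store 11 w) (word_store 11 (select_fun ls pM sN w))
      (TM (size w)).
  apply: ExecLe (exM w hw) _; rewrite /TM.
  do 3 (apply: leq_add; last by rewrite leq_mul2l poly_eval_mono).
  by do 3 (apply: leq_add; last exact: cost_mono).
have pD : is_poly TD by have := is_poly_horner_cost qD; rewrite /TD => ?; is_poly.
have pM' : is_poly TM.
  by have := is_poly_horner_cost ls; have := is_poly_horner_cost pM; have := is_poly_horner_cost sN; rewrite /TM => *; is_poly.
have [D' [tD' [hD' outD]]] := @exec_then_machine 6 _ _ _ _ _ isT (wf_sampler qD) hD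
  pD exD (@sampler_input qD).
have [M' [tM' [hM' outM]]] := @exec_then_machine 11 _ _ _ _ _ isT (wf_select ls pM sN) hM
  pM' exM
  (fun w hw => or_introl (select_fun_input ls pM sN hw)).
(* The empty coefficient list evaluates to 0, so [M'] gets no coins. *)
exists M', D', tM', tD', qs, [::], ns; do 3 split => //.
move=> x; have {hL} := hL x; rewrite /=.
set n := size x; rewrite hqs hns -/(s n) -/(q n) -/(p n).
pose g u := sampler_out D tD n u.
pose f t := sampler_out D' tD' n t.
have hf t : f t = if nth false t (q n) then true :: drop (q n).+1 t else g (take (q n) t).
  have hw : input_word (nseq n One ++ Sep :: enc_bits t).
    by rewrite input_cat /= (bits_input (enc_bits_bit t)) /input_word all_nseq orbT.
  have [h0 h1] := outD _ hw; rewrite /f /g /sampler_out.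
  move: h0 h1; rewrite sampler_fun_enc -/(q n); case: ifP => _.
    move=> _ /(_ erefl) [hh hr]; rewrite -[RHS]enc_bitsK.
    apply: (@bits_prefix_tape_eq (chead _ :: cright _) (enc_bits (true :: _))).
    by case=> [|j] //=; apply: hr.
  move=> /(_ _) h0 _; rewrite (out_bits_conf_eq (h0 _)) //.
  by rewrite input_cat /= (bits_input (enc_bits_bit _)) /input_word all_nseq orbT.
pose A acc v := accepts (output M tM (enc_input x [seq (g u, L (g u)) | u <- acc] v)).
have hl t : size t = q n + (1 + (p n + B n)) ->
    (poly_eval ls n <= size (f t)) = nth false t (q n).
  move=> st; rewrite hls hf; case: ifP => _; first by rewrite /= size_drop; lia.
  set u := take (q n) t.
  have su : size u = q n by rewrite /u size_take_min; lia.
  have sw : size (nseq n One ++ Sep :: enc_bits u) = n + (q n + 1).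
    by rewrite size_cat size_nseq /= size_map su addn1.
  have := size_out_bits D tD (nseq n One ++ Sep :: enc_bits u); rewrite sw => hs.
  apply/negbTE; rewrite -ltnNge addn1 ltnS; apply: leq_trans hs _.
  by rewrite /B leq_addl.
have key (w : {ffun 'I_(3 * (s n + (q n * s n + p n) + 4)) ->
                 (q n + (1 + (p n + B n))).-tuple bool} * 0.-tuple bool) :
  accepts (output M' tM' (enc_input x
    [seq (sampler_out D' tD' n (w.1 i), L (sampler_out D' tD' n (w.1 i)))
    | i <- enum 'I_(3 * (s n + (q n * s n + p n) + 4))] w.2)) =
  (let y := proc (q n) (p n) (samples w.1) [::] (s n) None in A y.1 (odflt [::] y.2)).
  have -> : val w.2 = [::] by rewrite (tuple0 w.2).
  set T := [seq _ | i <- _]; have hT := enc_input_input x T [::].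
  have [/(_ (select_fun_input _ _ _ hT)) [_ hh _ _] _] := outM _ hT.
  rewrite /accepts {}hh [chead _]/= -/(accepts _) select_fun_enc -/n -/(s n) -/(p n).
  have hlt t : t \in samples w.1 -> (poly_eval ls n <= size (f t)) = nth false t (q n).
    by case/mapP => i _ ->; apply: hl; rewrite size_tuple.
  have := pick_proc (p n) L [::] (s n) [::] hf hlt.
  by rewrite /samples -map_comp => -[-> ->].
have eB := eq_finset _ key.
have eA : [set w : {ffun 'I_(s n) -> (q n).-tuple bool} * (p n).-tuple bool |
    accepts (output M tM (enc_input x
      [seq (sampler_out D tD n (w.1 i), L (sampler_out D tD n (w.1 i)))
      | i <- enum 'I_(s n)] w.2))] = [set w | A (samples w.1) (val w.2)].
  by apply/setP => w; rewrite !inE /A /samples -map_comp.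
rewrite {}eA {}eB; have err := @process_error (q n) (p n) (B n) (s n) _ _ (leqnn _).
case: ifP => _; last exact: err.
(* For [x] in [L] the error bound is applied to the event of rejection. *)
move=> h; have {}err := err (fun g v => ~~ A g v).
have c1 := card_set_compl (fun w : {ffun 'I_(s n) -> (q n).-tuple bool} * (p n).-tuple bool =>
  A (samples w.1) (val w.2)).
have c2 := card_set_compl (fun w : {ffun 'I_(3 * (s n + (q n * s n + p n) + 4)) ->
                 (q n + (1 + (p n + B n))).-tuple bool} * 0.-tuple bool =>
  let y := proc (q n) (p n) (samples w.1) [::] (s n) None in A y.1 (odflt [::] y.2)).
rewrite (majority_compl c2); apply: err.
by rewrite -(majority_compl c1).
Qed.
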